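(* Let $G$ be a finite group. (i) Let $\mathfrak{F}$ be a normally hereditary saturated formation containing all nilpotent groups and let $\Delta$ be the set of all $\mathfrak{F}$-central chief factors of $G$. If the $\mathfrak{F}$-residual $D=G^{\mathfrak{F}}$ of $G$ is soluble and ${\cal L}_{\mathfrak{F}}(G)={\cal L}_{\Delta}(G)$, then $D$ is an abelian Hall subgroup of odd order of $G$, every element of $G$ induces (by conjugation) a power automorphism in $D/\Phi(D)$, and every chief factor of $G$ below $D$ is cyclic. (ii) Let $G$ be soluble and let $\Delta$ be the set of all central chief factors $H/K$ of $G$, that is, those with $H/K\leq Z(G/K)$. Let $\mathfrak{N}$ be the class of all nilpotent groups. If ${\cal L}_{\mathfrak{N}}(G)={\cal L}_{\Delta}(G)$, then every element of $G$ induces (by conjugation) a power automorphism in $G^{\mathfrak{N}}$.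
   Context: All groups are finite; classes of groups are closed under isomorphism and contain all identity (trivial) groups. For $A\le G$: $A^{G}$ is the normal closure of $A$ in $G$ and $A_{G}=\bigcap_{x\in G}A^{x}$ is the core of $A$ in $G$. $\Phi(X)$ is the Frattini subgroup of $X$. A chief factor of $G$ is a section $H/K$ with $K<H$ normal in $G$ and $H/K$ a minimal normal subgroup of $G/K$; it is below $D$ if $H\le D$. A chief factor $H/K$ of $G$ is $\mathfrak{F}$-central in $G$ if $(H/K)\rtimes (G/C_{G}(H/K))\in\mathfrak{F}$, where $G/C_G(H/K)$ acts on $H/K$ by conjugation. For a set $\Delta$ of chief factors of $G$ and normal subgroups $L\le T$ of $G$, write $T/L\le Z_{\Delta}(G)$ if either $L=T$, or $L<T$ and $H/K\in\Delta$ for every chief factor $H/K$ of $G$ with $L\le K<H\le T$. ${\cal L}_{\Delta}(G)$ is the set of all subgroups $A$ of $G$ such that $A^{G}/A_{G}\le Z_{\Delta}(G)$. For a class $\mathfrak{F}$, ${\cal L}_{\mathfrak{F}}(G)$ is the set of all subgroups $A$ of $G$ such that $A^{G}/A_{G}\in\mathfrak{F}$. $G^{\mathfrak{F}}$ (the $\mathfrak{F}$-residual) is the intersection of all normal subgroups $N$ of $G$ with $G/N\in\mathfrak{F}$. The class $\mathfrak{F}$ is: normally hereditary if $H\in\mathfrak{F}$ whenever $H\trianglelefteq G\in\mathfrak{F}$; saturated if $G\in\mathfrak{F}$ whenever $G^{\mathfrak{F}}\le\Phi(G)$; a formation if for every group $G$ every homomorphic image of $G/G^{\mathfrak{F}}$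 belongs to $\mathfrak{F}$. A power automorphism of a group is an automorphism mapping every subgroup onto itself. A Hall subgroup of $G$ is a subgroup whose order and index are coprime. *)

(* Defs.v *)
From mathcomp Require Import all_boot all_fingroup all_solvable.
From mathcomp Require Import boolp.

Set Implicit Arguments.
Unset Strict Implicit.
Unset Printing Implicit Defensive.

Local Open Scope group_scope.

Definition gclass := forall gT : finGroupType, {group gT} -> Prop.

Definition is_gclass (F : gclass) : Prop :=
  (forall (gT rT : finGroupType) (G : {group gT}) (H : {group rT}),
      G \isog H -> F gT G -> F rT H)
  /\ (forall gT : finGroupType, F gT 1%G).

Definition nilpotent_gclass : gclass := fun gT G => nilpotent G.

(* `[< P >] is the classical truth value of P; a big intersection over bool
   predicates inherits its group structure. *)
Definition residual (F : gclass) (gT : finGroupType) (G : {group gT}) :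
    {group gT} :=
  [group of \bigcap_(N : {group gT} | (N <| G) && `[< F _ (G / N)%G >]) N].

Definition normally_hereditary (F : gclass) : Prop :=
  forall (gT : finGroupType) (G H : {group gT}), H <| G -> F gT G -> F gT H.

Definition saturated (F : gclass) : Prop :=
  forall (gT : finGroupType) (G : {group gT}),
    residual F G \subset 'Phi(G) -> F gT G.

Definition formation (F : gclass) : Prop :=
  forall (gT rT : finGroupType) (G : {group gT})
         (f : {morphism (G / residual F G) >-> rT}),
    F rT (f @* (G / residual F G))%G.

(* The library's [chief_factor G K H] says that H / K is a chief factor of G;
   binary predicates on subgroups below take K and H in this same order. *)

Section ChiefSemidirect.

Variables (gT : finGroupType) (G K H : {group gT}).

(* 'Q is conjugation on cosets of K. *)
Definition section_cent : {group gT} := 'C_G(H / K | 'Q)%G.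

Hypothesis chKH : chief_factor G K H.

Let nsK : K \subset H /\ G \subset 'N(K).
Proof. by case/andP: chKH => /maxgroupP[/andP[/andP[]]]. Qed.

Let nGH : G \subset 'N(H).
Proof. by case/andP: chKH => _ /andP[]. Qed.

Lemma chief_acts :
  {acts G / section_cent, on group H / K | 'Q %% section_cent}.
Proof.
have [_ nGK] := nsK.
split=> /=.
  rewrite astabs_mod ?subsetIr // quotientS //; exact: actsQ.
apply/subsetP=> X HX; rewrite !inE; apply/andP; split.
  by apply: (subsetP (quotientS _ (subsetT H))).
apply/subsetP=> a /setIP[_ /setIP[_ cHa]].
by rewrite inE (astab_act cHa).
Qed.

(* (H / K) ><| (G / C_G(H / K)), realised as the full group of this type. *)
Definition chief_sdprod : finGroupType := sdprod_by <[chief_acts]>%gact.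

Lemma chief_actE : {in H & G, forall h g,
  <[chief_acts]>%act (coset K h) (coset section_cent g) = coset K (h ^ g)}.
Proof.
have [_ nGK] := nsK.
have nHK : H \subset 'N(K).
  by case/andP: chKH => _ /andP[sHG _]; apply: subset_trans sHG _.
have nGC : G \subset 'N(section_cent).
  have nGHK : G \subset 'N(H / K | 'Q) by apply: actsQ.
  apply: normsI; first exact: normG.
  exact: subset_trans nGHK (astab_norm _ _).
move=> h g Hh Gg /=; have Ng := subsetP nGK g Gg; have Nh := subsetP nHK h Hh.
rewrite actbyE ?mem_quotient //= modactE ?qactJ ?dom_qactJ ?(subsetP nGC) //.
- by rewrite Ng -morphJ.
- by move: (Ng); rewrite -dom_qactJ.
apply/afixP=> a /setIP[_ /setIP[_ cHa]].
by rewrite (astab_act cHa) // mem_quotient.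
Qed.

End ChiefSemidirect.

Definition F_central (F : gclass) (gT : finGroupType) (G K H : {group gT}) :
    Prop :=
  exists chKH : chief_factor G K H, F (chief_sdprod chKH) [set: _]%G.

Definition central_chief (gT : finGroupType) (G K H : {group gT}) : Prop :=
  chief_factor G K H /\ H / K \subset 'Z(G / K).

Section Lattices.

Variables (gT : finGroupType) (G : {group gT}).

(* The relation T / L <= Z_Delta(G). *)
Definition quo_le_Z (Delta : {group gT} -> {group gT} -> Prop)
    (L T : {group gT}) : Prop :=
  L :=: T \/
  (L \proper T /\
   forall K H : {group gT},
     chief_factor G K H -> L \subset K -> H \subset T -> Delta K H).

Definition nclosure (A : {group gT}) : {group gT} := <<class_support A G>>%G.

Definition L_Delta (Delta : {group gT} -> {group gT} -> Prop)
    (A : {group gT}) : Prop :=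
  A \subset G /\ quo_le_Z Delta (gcore A G) (nclosure A).

Definition L_class (F : gclass) (A : {group gT}) : Prop :=
  A \subset G /\ F _ (nclosure A / gcore A G)%G.

End Lattices.

Definition power_aut (gT : finGroupType) (X : {group gT}) (a : {perm gT}) :
    Prop :=
  a \in Aut X /\ forall Y : {group gT}, Y \subset X -> a @: Y = Y.

(* Main.v *)
Require Import Defs.
From mathcomp Require Import all_boot all_fingroup all_solvable.
From mathcomp Require Import boolp.

Set Implicit Arguments.
Unset Strict Implicit.
Unset Printing Implicit Defensive.

Local Open Scope group_scope.

(** Write [D] for the residual of [G], and call a chief factor of [G] central
    when it is [F]-central.

    General facts on a saturated formation [F].  A chief factor [H / K] is
    governed by the fibre product [W] of two copies of [G] over [G / H]: the
    semidirect product of [H / K] by [G / 'C_G(H / K)] is a quotient of [W]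
    ([fibre_map]).  As [W] is a subdirect product, [H / K] is central as soon
    as [G / K] is in [F] ([chief_central_residual]).  Conversely, if [H / K] is
    abelian and central and [G / H] is in [F], then [G / K] is in [F]
    ([F_central_ext]): either [H / K] lies in the Frattini subgroup and
    saturation applies, or it has a complement, and the semidirect product is a
    quotient of [G].  Centrality is invariant under perspectivity
    ([F_central_perspective]), and [D] centralises every central chief factor
    ([residual_section_cent]).

    Nilpotency of [D].  A chief factor below [D] is abelian.  A noncentral one
    is cyclic: a subgroup [A] between [K] and [H] that is not normal in [G] has
    core [K] and normal closure [H], so the equality of the two lattices makes
    [H / K] central.  Cyclic sections have abelian automorphism groups, so [D]
    centralises all chief factors below it and is nilpotent
    ([residual_nilpotent]).

    The top of [D].  A chief factor [D / R] is never central, since otherwise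
    [G / R] would be in [F].  So if [A] is a subgroup of [D] whose core is in
    [R], then [A] is in [R] ([gcore_top]).  Let [p] be the order of [D / R]
    and [P] the Sylow [p]-subgroup of [D].  Every cyclic subgroup of [P] not
    contained in [R] is then normal in [G] ([top_cycle_norm]).  An element of
    [G] that moves [D / R] forces [P] to be abelian and [p] to be odd, by
    comparing exponents.  Every maximal subgroup of [P] turns out to be normal
    in [G], so that its product with the Hall [p']-subgroup of [D] can play the
    role of [R]; and the elements of the Frattini subgroup of [P] are [p]-th
    powers.  So every subgroup of [D] is normal in [G]
    ([residual_subgroup_norm]).
    This is stronger than the claim on power automorphisms and on chief
    factors.

    The Hall property.  Suppose that [p] divides both [#|D / R|] and
    [#|G : D|].  By saturation [D / R] has a complement, which contains an
    element [a] of order [p] modulo [R]; take [b] in [D] outside [R].  The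
    normal closures of [<[a]> R] and [<[a * b]> R] meet [D] in [R]
    ([nclosure_TI]), but together they contain [D].  Perspectivities then
    identify [D / R] with a chief factor of [G / D], which is central, a
    contradiction ([top_coprime_index]).

    Part (ii) is the case of nilpotent groups, for which [F]-central chief
    factors are the central ones ([nilpotent_central]). *)

(* Keeps simplification from exposing the intersection behind a residual. *)
Local Arguments residual : simpl never.

(** * Residuals of formations *)

Section Formation.

Variable F : gclass.
Hypothesis clF : is_gclass F.
Hypothesis formF : formation F.

Lemma gclass_isog (gT rT : finGroupType) (G : {group gT}) (H : {group rT}) :
  G \isog H -> F G -> F H.
Proof. by have [isoF _] := clF; apply: isoF. Qed.

Section Residual.

Variable gT : finGroupType.
Implicit Types G N : {group gT}.

Lemma residual_sub G N : N <| G -> F (G / N)%G -> residual F G \subset N.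
Proof.
move=> nsNG FGN; apply: (bigcap_inf N) => /=.
by rewrite nsNG; apply/asboolP.
Qed.

Lemma residual_normal G : residual F G <| G.
Proof.
apply/andP; split=> /=; last first.
  rewrite norms_bigcap //; apply/bigcapsP=> N /andP[/andP[_ nNG] _] //.
apply: (bigcap_inf G) => /=; rewrite normal_refl; apply/asboolP.
have [isoF F1] := clF; apply: isoF (F1 gT); apply: trivial_isog => //=.
exact: trivg_quotient.
Qed.

Lemma residual_quotient G : F (G / residual F G)%G.
Proof.
have := formF (idm_morphism (G / residual F G)%G).
apply: gclass_isog.
by rewrite /= morphim_idm //; apply: isog_refl.
Qed.

Lemma residual_subP G N :
  N <| G -> F (G / N)%G <-> residual F G \subset N.
Proof.
move=> nsNG; split; first exact: residual_sub.
move=> sRN; have nsRG := residual_normal G.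
have nR_GR : G / residual F G \subset 'N(N / residual F G).
  exact: quotient_norms (normal_norm nsNG).
have := formF (restrm_morphism nR_GR (coset_morphism _)).
apply: gclass_isog; rewrite /= morphim_restrm setIid.
by apply: third_isog.
Qed.

End Residual.

Lemma gclass_morphim (gT rT : finGroupType) (D G N : {group gT})
    (f : {morphism D >-> rT}) :
    G \subset D -> N <| G -> F (G / N)%G -> N \subset 'ker f ->
  F (f @* G)%G.
Proof.
move=> sGD nsNG /(residual_subP nsNG) sRN sNK.
have: F (G / 'ker_G f)%G.
  apply/residual_subP => //=.
    by rewrite -(ker_restrm sGD f) ker_normal.
  by rewrite subsetI (normal_sub (residual_normal G)) (subset_trans sRN).
by apply: gclass_isog; apply: first_isog_loc.
Qed.

Lemma residual_ker (gT rT : finGroupType) (G : {group gT})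
    (f : {morphism G >-> rT}) :
  F (f @* G)%G -> residual F G \subset 'ker f.
Proof.
move=> FfG; apply/residual_subP; first exact: ker_normal.
by apply: gclass_isog FfG; rewrite isog_sym; apply: first_isog.
Qed.

End Formation.

(** * Chief factors, their centralisers and fibre products *)

Section ChiefFactors.

Variable gT : finGroupType.
Implicit Types G H K L X : {group gT}.

Lemma chief_factorP G K H :
  chief_factor G K H ->
  [/\ K <| G, H <| G, K \proper H &
      forall X, K \subset X -> X \subset H -> G \subset 'N(X) ->
        X :=: K \/ X :=: H].
Proof.
case/andP=> /maxgroupP[/andP[prKH nKG] maxK] nsHG.
have sHG := normal_sub nsHG.
split=> //; first by rewrite /normal nKG (subset_trans (proper_sub prKH)).
move=> X sKX sXH nXG; have [-> | neXH] := eqVneq (X : {set gT}) H.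
  by right.
by left; apply: maxK => //; rewrite nXG properEneq neXH sXH.
Qed.

Lemma chief_factorI G K H :
  K <| G -> H <| G -> K \proper H ->
  (forall X, K \subset X -> X \subset H -> G \subset 'N(X) ->
     X :=: K \/ X :=: H) ->
  chief_factor G K H.
Proof.
move=> nsKG nsHG prKH maxK; rewrite /chief_factor nsHG andbT.
apply/maxgroupP; split; first by rewrite prKH normal_norm.
move=> X /andP[prXH nXG] sKX.
have [// | eXH] := maxK X sKX (proper_sub prXH) nXG.
by rewrite eXH properxx in prXH.
Qed.

Lemma chief_factor_cyclic G K H :
    chief_factor G K H ->
    (forall X, K \subset X -> X \subset H -> G \subset 'N(X)) ->
  cyclic (H / K).
Proof.
move=> chKH nXG; have [nsKG nsHG prKH maxK] := chief_factorP chKH.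
have [sKH [h Hh nKh]] := properP prKH.
have nKh' : h \in 'N(K).
  by rewrite (subsetP (normal_norm nsKG)) ?(subsetP (normal_sub nsHG)).
have nKcy : <[h]> \subset 'N(K) by rewrite cycle_subG.
have sKX : K \subset <[h]> <*> K by apply: joing_subr.
have sXH : <[h]> <*> K \subset H by rewrite join_subG cycle_subG Hh.
have [||| eqX | eqX] := maxK (<[h]> <*> K)%G => //; first exact: nXG.
  by case/negP: nKh; rewrite -eqX mem_gen // inE cycle_id.
by rewrite -eqX quotientYidr // quotient_cycle // cycle_cyclic.
Qed.

Lemma section_centP G K H x :
    K <| G -> H <| G ->
  reflect (x \in G /\ forall h, h \in H -> [~ h, x] \in K)
          (x \in section_cent G K H).
Proof.
move=> nsKG nsHG; have nKG := normal_norm nsKG.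
have nKH := subset_trans (normal_sub nsHG) nKG.
rewrite /section_cent /= in_setI astabQR // inE.
apply: (iffP and3P) => [[Gx _ sRK] | [Gx cHx]].
  split=> // h Hh; rewrite -invg_comm groupV (subsetP sRK) //.
  by rewrite mem_commg ?set11.
split; rewrite ?(subsetP nKG) // gen_subG; apply/subsetP=> _ /imset2P[y h /set1P-> Hh ->].
by rewrite -invg_comm groupV cHx.
Qed.

Lemma section_cent_normal G K H :
  K <| G -> H <| G -> section_cent G K H <| G.
Proof.
move=> nsKG nsHG; rewrite /normal subsetIl; apply/subsetP=> x Gx.
rewrite inE; apply/subsetP=> _ /imsetP[y Cy ->].
have [Gy cy] := section_centP y nsKG nsHG Cy.
apply/(section_centP _ nsKG nsHG); split; first by rewrite groupJ.
move=> h Hh; rewrite -[h](conjgKV x) -conjRg.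
rewrite memJ_norm ?(subsetP (normal_norm nsKG)) // cy //.
by rewrite memJ_norm // groupV (subsetP (normal_norm nsHG)).
Qed.

Lemma section_cent_sub G K H : 
  K <| G -> H <| G -> K \subset section_cent G K H.
Proof.
move=> nsKG nsHG; apply/subsetP=> k Kk; apply/(section_centP _ nsKG nsHG).
split=> [|h Hh]; first exact: (subsetP (normal_sub nsKG)).
rewrite commgEr groupM // memJ_norm ?groupV //.
by rewrite (subsetP (normal_norm nsKG)) // (subsetP (normal_sub nsHG)).
Qed.

Lemma abelian_section_commg G K H x y :
    K <| G -> H <| G -> abelian (H / K) -> x \in H -> y \in H ->
  [~ x, y] \in K.
Proof.
move=> nsKG nsHG abHK Hx Hy.
have nKH := subset_trans (normal_sub nsHG) (normal_norm nsKG).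
apply: (subsetP (_ : [~: H, H] \subset K)); last exact: mem_commg.
by rewrite -quotient_cents2.
Qed.

Lemma abelian_section_cent G K H :
  K <| G -> H <| G -> abelian (H / K) -> H \subset section_cent G K H.
Proof.
move=> nsKG nsHG abHK; apply/subsetP=> x Hx.
apply/(section_centP _ nsKG nsHG); split; first exact: (subsetP (normal_sub nsHG)).
by move=> h Hh; apply: (abelian_section_commg nsKG nsHG).
Qed.

Lemma chief_complement G K H :
    chief_factor G K H -> abelian (H / K) -> ~~ (H / K \subset 'Phi(G / K)) ->
  exists M : {group gT}, [/\ K \subset M, M \subset G, H * M = G & H :&: M = K].
Proof.
move=> chKH abHK nPhi; have [nsKG nsHG prKH maxK] := chief_factorP chKH.
have [[nKG nHG] sHG] := (normal_norm nsKG, normal_norm nsHG, normal_sub nsHG).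
have [Mb /andP[maxM nHM] | noM] :=
  pickP [pred Mb : {group coset_of K} |
         maximal_eq Mb (G / K) && ~~ (H / K \subset Mb)]; last first.
  case/negP: nPhi; apply/bigcapsP=> Mb maxM; apply: contraFT (noM Mb) => nHM /=.
  by rewrite maxM.
have /maximal_eqP[sMG maxMP] := maxM.
have defG: (H / K) * Mb = G / K.
  have nHM' : Mb \subset 'N(H / K) by rewrite (subset_trans sMG) ?quotient_norms.
  rewrite -norm_joinEr //.
  have [||eqM|//] := maxMP (H / K <*> Mb)%G; first exact: joing_subr.
    by rewrite join_subG quotientS.
  by case/negP: nHM; rewrite -eqM joing_subl.
exists (coset K @*^-1 Mb)%G; set M := (_ @*^-1 _)%G.
have sKM : K \subset M by apply: sub_cosetpre.
have sMG' : M \subset G by rewrite -(quotientGK nsKG) morphpreS.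
have HMG : H * M = G.
  apply/eqP; rewrite eqEsubset mul_subG //=; apply/subsetP=> g Gg.
  have Ng := subsetP nKG g Gg.
  have: coset K g \in (H / K) * Mb by rewrite defG mem_quotient.
  case/mulsgP=> h' m /morphimP[h Nh Hh ->] Mm eq_g.
  apply/mulsgP; exists h (h^-1 * g); rewrite ?mulKVg //.
  apply/morphpreP; split; first by rewrite groupM ?groupV.
  rewrite /= coset_morphM ?groupV // morphV //=.
  by rewrite eq_g mulKg.
split=> //; have nHMG : G \subset 'N(H :&: M).
  rewrite -HMG mul_subG //; last first.
    by rewrite normsI ?normG // (subset_trans sMG').
  apply/subsetP=> h Hh; rewrite inE; apply/subsetP=> _ /imsetP[x /setIP[Hx Mx] ->].
  rewrite in_setI groupJ //= conjg_mulR groupM // (subsetP sKM) //.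
  exact: (abelian_section_commg nsKG nsHG).
have [|||//|eqHM] := maxK (H :&: M)%G; rewrite ?subsetIl //.
  by rewrite subsetI sKM proper_sub.
case/negP: nHM; have sHM : H \subset M by rewrite -eqHM subsetIr.
by apply: subset_trans (quotientS K sHM) _; rewrite cosetpreK.
Qed.

(** Perspectivity: [H / (H :&: L)] and [HL / L] are chief together. *)
Lemma chief_factor_up G H L :
  H <| G -> L <| G -> chief_factor G (H :&: L)%G H ->
  chief_factor G L (H <*> L)%G.
Proof.
move=> nsHG nsLG ch; have [_ _ prI maxI] := chief_factorP ch.
have nLH := subset_trans (normal_sub nsHG) (normal_norm nsLG).
apply: chief_factorI => //; first exact: normalY.
  rewrite properEneq joing_subr andbT; apply: contraTneq prI => eqL.
  have sHL : H \subset L by rewrite eqL joing_subl.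
  by rewrite /= (setIidPl sHL) properxx.
move=> X sLX sXHL nXG.
have eqX : (X :&: H) * L = X.
  by rewrite group_modr // -norm_joinEl //; apply/setIidPl.
have [||| eqI | eqI] := maxI (X :&: H)%G.
- by rewrite /= setIC setSI.
- exact: subsetIr.
- by rewrite normsI // normal_norm.
- left; rewrite -eqX (eqI : X :&: H = H :&: L).
  by apply/eqP; rewrite eqEsubset mul_subG ?subsetIr //= mulG_subr.
by right; rewrite -eqX /= (eqI : X :&: H = H) norm_joinEl.
Qed.

Lemma chief_factor_down G H L :
  H <| G -> L <| G -> chief_factor G L (H <*> L)%G ->
  chief_factor G (H :&: L)%G H.
Proof.
move=> nsHG nsLG ch; have [_ _ prL maxL] := chief_factorP ch.
have nLH := subset_trans (normal_sub nsHG) (normal_norm nsLG).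
apply: chief_factorI => //; first exact: normalI.
  rewrite properEneq subsetIl andbT; apply: contraTneq prL => eqH.
  have sHL : H \subset L by rewrite -eqH subsetIr.
  by rewrite /= (joing_idPr sHL) properxx.
move=> X sIX sXH nXG; have nLX := subset_trans sXH nLH.
have eqX : H :&: (X * L) = X.
  rewrite setIC -group_modl // setIC; apply/eqP.
  by rewrite eqEsubset mulG_subl mul_subG.
rewrite -norm_joinEl // in eqX.
have [||| eqL | eqL] := maxL (X <*> L)%G.
- exact: joing_subr.
- by rewrite genS // setSU.
- by rewrite normsY // normal_norm.
- left; apply/eqP; rewrite eqEsubset sIX andbT.
  by rewrite -{1}eqX /=; rewrite /= in eqL; rewrite eqL.
right; rewrite -eqX /=; rewrite /= in eqL; rewrite eqL.
by apply/setIidPl; rewrite joing_subl.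
Qed.

Lemma section_cent_perspective G H L :
    H <| G -> L <| G ->
  section_cent G (H :&: L)%G H = section_cent G L (H <*> L)%G.
Proof.
move=> nsHG nsLG; have nsIG : (H :&: L)%G <| G by apply: normalI.
have nsYG : (H <*> L)%G <| G by apply: normalY.
have nLH := subset_trans (normal_sub nsHG) (normal_norm nsLG).
apply/group_inj/setP=> x.
apply/(section_centP _ nsIG nsHG)/(section_centP _ nsLG nsYG).
  case=> Gx cx; split=> // y; rewrite /= norm_joinEl // => /mulsgP[h l Hh Ll ->].
  have nLG := subsetP (normal_norm nsLG).
  have Ilh : [~ h, x] \in L by have /setIP[] := cx h Hh.
  rewrite commMgJ groupM // ?memJ_norm // ?nLG // ?(subsetP (normal_sub nsLG)) //.
  by rewrite commgEl groupM ?groupV // memJ_norm ?nLG.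
case=> Gx cx; split=> // h Hh; rewrite in_setI cx ?mem_gen ?inE ?Hh // andbT.
by rewrite commgEl groupM ?groupV // memJ_norm // (subsetP (normal_norm nsHG)).
Qed.

(** Pairs of elements of [G] that agree modulo [H]. *)
Definition fibre_set G H : {set gT * gT} :=
  [set u in setX G G | u.2^-1 * u.1 \in H].

Lemma fibre_group_set G H : H <| G -> group_set (fibre_set G H).
Proof.
case/andP=> sHG nHG; apply/group_setP; split.
  by rewrite !inE /= !group1 mulg1 invg1 group1.
move=> [x1 x2] [y1 y2]; rewrite !inE /=.
move=> /andP[/andP[Gx1 Gx2] Hx] /andP[/andP[Gy1 Gy2] Hy].
rewrite (groupM Gx1 Gy1) (groupM Gx2 Gy2) /= invMg.
have ->: y2^-1 * x2^-1 * (x1 * y1) = (x2^-1 * x1) ^ y2 * (y2^-1 * y1).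
  by rewrite /conjg !mulgA mulgK.
by rewrite groupM // memJ_norm // (subsetP nHG).
Qed.

(** The fibre product of two copies of [G] over [G / H]; the set above is a
    group when [H] is normal, and generation makes it a group in all cases. *)
Definition fibre G H : {group gT * gT} := <<fibre_set G H>>%G.

Lemma mem_fibre G H u : H <| G ->
  (u \in fibre G H) = [&& u.1 \in G, u.2 \in G & u.2^-1 * u.1 \in H].
Proof.
move=> nsHG; rewrite /fibre /= (gen_set_id (fibre_group_set nsHG)) !inE.
by rewrite -andbA.
Qed.

(** The pairs that agree modulo [K] and centralise [H / K]: the kernel of the
    map from the fibre product to the semidirect product below. *)
Definition fibre_ker G K H : {group gT * gT} :=
  (fibre G K :&: setX G (section_cent G K H))%G.

Lemma mem_fibre_ker G K H u : K <| G -> 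
  (u \in fibre_ker G K H) =
     [&& u.1 \in G, u.2 \in section_cent G K H & u.2^-1 * u.1 \in K].
Proof.
move=> nsKG; case: u => x y; rewrite in_setI mem_fibre // in_setX /=.
case: (x \in G) => //=; rewrite andbC andbA; congr (_ && _).
by apply: andb_idr => /setIP[].
Qed.

Lemma fibre_ker_left G K H k :
  K <| G -> k \in K -> (k, 1) \in fibre_ker G K H.
Proof.
move=> nsKG Kk; rewrite mem_fibre_ker //; apply/and3P; split => /=.
- exact: (subsetP (normal_sub nsKG)).
- exact: (group1 (section_cent G K H)).
by rewrite invg1 mul1g.
Qed.

Section Map.

Variables G K H : {group gT}.
Hypothesis chKH : chief_factor G K H.

Notation act := (<[chief_acts chKH]>%gact).
Notation C := (section_cent G K H).

(** The surjection of the fibre product onto the semidirect product of [H / K]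
    by [G / 'C_G(H / K)], sending [(y * h, y)] to the class of [y] times the
    class of [h]. *)
Definition fibre_map (u : gT * gT) : chief_sdprod chKH :=
  sdpair2 act (coset C u.2) * sdpair1 act (coset K (u.2^-1 * u.1)).

Lemma fibre_map_morphM : {in fibre G H &, {morph fibre_map : u v / u * v}}.
Proof.
have [nsKG nsHG prKH _] := chief_factorP chKH.
have nKG := normal_norm nsKG.
have nCG := normal_norm (section_cent_normal nsKG nsHG).
move=> [x1 x2] [y1 y2]; rewrite !mem_fibre //=.
move=> /and3P[Gx1 Gx2 Hx] /and3P[Gy1 Gy2 Hy].
rewrite /fibre_map /=.
have ->: (x2 * y2)^-1 * (x1 * y1) = (x2^-1 * x1) ^ y2 * (y2^-1 * y1).
  by rewrite invMg /conjg !mulgA mulgK.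
have nC x: x \in G -> x \in 'N(C) by apply: subsetP.
have nK x: x \in G -> x \in 'N(K) by apply: subsetP.
have sHG := subsetP (normal_sub nsHG).
have HxJ: (x2^-1 * x1) ^ y2 \in H.
  by rewrite memJ_norm // (subsetP (normal_norm nsHG)).
rewrite coset_morphM ?nC // (coset_morphM (nK _ (sHG _ HxJ))) ?nK ?sHG //.
rewrite (sdpair1_morphM act) ?mem_quotient // (sdpair2_morphM act) ?mem_quotient //.
rewrite -(chief_actE chKH) // sdpair_act ?mem_quotient //.
by rewrite -!mulgA; congr (_ * _); apply: mulKVg.
Qed.

Canonical fibre_morphism := Morphism fibre_map_morphM.

Lemma fibre_map_im : fibre_map @* fibre G H = [set: chief_sdprod chKH].
Proof.
have [nsKG nsHG prKH _] := chief_factorP chKH.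
apply/eqP; rewrite eqEsubset subsetT /=; apply/subsetP=> w _.
have: w \in sdpair1 act @* (H / K) * sdpair2 act @* (G / C).
  by rewrite im_sdpair.
rewrite -(normC (im_sdpair_norm act)).
case/mulsgP=> a b /morphimP[c _ /morphimP[g _ Gg ->] ->].
move=> /morphimP[d _ /morphimP[h _ Hh ->] ->] ->.
apply/morphimP; exists (g * h, g).
- by rewrite mem_fibre //= Gg mulKg Hh groupM // (subsetP (normal_sub nsHG)).
- by rewrite mem_fibre //= Gg mulKg Hh groupM // (subsetP (normal_sub nsHG)).
by rewrite /= /fibre_map /= mulKg.
Qed.

Lemma fibre_map_ker : 'ker fibre_map = fibre_ker G K H.
Proof.
have [nsKG nsHG prKH _] := chief_factorP chKH.
have nKG := normal_norm nsKG.
have nCG := normal_norm (section_cent_normal nsKG nsHG).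
have sHG := subsetP (normal_sub nsHG).
apply/setP=> u; rewrite mem_fibre_ker //; apply/idP/idP.
  case/morphpreP; rewrite mem_fibre // => /and3P[Gu1 Gu2 Hu] /set1P.
  move/(canRL (mulgK _)); rewrite mul1g => eq_u.
  have QG := mem_quotient [group of C] Gu2.
  have QH := mem_quotient K Hu.
  have: sdpair2 act (coset C u.2)
      \in (sdpair1 act @* (H / K)) :&: (sdpair2 act @* (G / C)).
    rewrite inE {1}eq_u groupV.
    rewrite (mem_morphim (sdpair1_morphism act)) //.
    by rewrite (mem_morphim (sdpair2_morphism act)).
  rewrite im_sdpair_TI => /set1P u21.
  have Cu2: u.2 \in C.
    apply: coset_idr; first exact: (subsetP nCG).
    by apply/(injmP (injm_sdpair2 act)); rewrite ?group1 ?u21 ?morph1.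
  rewrite Gu1 Cu2 /=; apply: coset_idr.
    by rewrite (subsetP nKG) ?groupM ?groupV.
  apply/(injmP (injm_sdpair1 act)); rewrite ?group1 ?morph1 //.
  by apply: invg_inj; rewrite -eq_u u21 invg1.
case/and3P=> Gu1 Cu2 Ku; have Gu2: u.2 \in G by case/setIP: Cu2.
have Hu := subsetP (proper_sub prKH) _ Ku.
apply/morphpreP; rewrite mem_fibre // Gu1 Gu2 Hu; split=> //.
by rewrite inE /= /fibre_map (coset_id Cu2) (coset_id Ku) !morph1 mulg1.
Qed.

End Map.

Lemma fibre_ker_normal G K H :
  chief_factor G K H -> fibre_ker G K H <| fibre G H.
Proof. by move=> chKH; rewrite -(fibre_map_ker chKH) ker_normal. Qed.

Lemma quotient_restr G K :
  K <| G -> {f : {morphism G >-> coset_of K} |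
               f =1 coset K & f @* G = G / K}.
Proof.
move=> nsKG; exists (restrm_morphism (normal_norm nsKG) (coset_morphism _)) => //.
by rewrite morphim_restrm setIid.
Qed.

End ChiefFactors.

Section FibreMorphisms.

Variables (gT rT : finGroupType) (G H : {group gT}).
Hypothesis nsHG : H <| G.
Variable g : {morphism G >-> rT}.

Lemma fibre_fstM : {in fibre G H &, {morph (fun u => g u.1) : u v / u * v}}.
Proof.
move=> u v; rewrite !mem_fibre // => /and3P[Gu _ _] /and3P[Gv _ _].
by rewrite /= morphM.
Qed.

Lemma fibre_sndM : {in fibre G H &, {morph (fun u => g u.2) : u v / u * v}}.
Proof.
move=> u v; rewrite !mem_fibre // => /and3P[_ Gu _] /and3P[_ Gv _].
by rewrite /= morphM.
Qed.

(** The morphism [g] applied to the first or to the second coordinate. *)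
Definition fibre_fst := Morphism fibre_fstM.
Definition fibre_snd := Morphism fibre_sndM.

Lemma fibre_fst_im : fibre_fst @* fibre G H = g @* G.
Proof.
apply/eqP; rewrite eqEsubset; apply/andP; split; apply/subsetP=> y.
  case/morphimP=> u _; rewrite mem_fibre // => /and3P[Gu _ _] -> /=.
  exact: mem_morphim.
case/morphimP=> x _ Gx ->.
have Wx: (x, x) \in fibre G H by rewrite mem_fibre //= Gx mulVg group1.
by apply/morphimP; exists (x, x).
Qed.

Lemma fibre_snd_im : fibre_snd @* fibre G H = g @* G.
Proof.
apply/eqP; rewrite eqEsubset; apply/andP; split; apply/subsetP=> y.
  case/morphimP=> u _; rewrite mem_fibre // => /and3P[_ Gu _] -> /=.
  exact: mem_morphim.
case/morphimP=> x _ Gx ->.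
have Wx: (x, x) \in fibre G H by rewrite mem_fibre //= Gx mulVg group1.
by apply/morphimP; exists (x, x).
Qed.

End FibreMorphisms.

(** * F-central chief factors *)

Section Central.

Variable F : gclass.
Hypothesis clF : is_gclass F.
Hypothesis formF : formation F.
Variable gT : finGroupType.
Implicit Types G H K L M X : {group gT}.

Lemma F_central_chief G K H : F_central F G K H -> chief_factor G K H.
Proof. by case. Qed.

(** Centrality read off inside [G * G], without the semidirect product. *)
Lemma F_centralP G K H :
    chief_factor G K H ->
  F_central F G K H <-> F (fibre G H / fibre_ker G K H)%G.
Proof.
move=> chKH; have isoW (ch : chief_factor G K H) :
    fibre G H / fibre_ker G K H \isog [set: chief_sdprod ch]%G.
  have := first_isog (fibre_morphism ch).
  by rewrite /= fibre_map_ker fibre_map_im.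
split=> [[ch Fch] | FW].
  by apply: gclass_isog Fch; rewrite // isog_sym.
by exists chKH; apply: gclass_isog FW.
Qed.

Lemma F_central_cent G K H :
  F_central F G K H -> F (G / section_cent G K H)%G.
Proof.
move=> FKH; have chKH := F_central_chief FKH.
have [nsKG nsHG _ _] := chief_factorP chKH.
have nsCG := section_cent_normal nsKG nsHG.
have [f fE fG] := quotient_restr nsCG.
have FW := (F_centralP chKH).1 FKH.
have := gclass_morphim clF formF (f := fibre_snd nsHG f) (subxx _)
          (fibre_ker_normal chKH) FW.
rewrite (group_inj (etrans (fibre_snd_im nsHG f) fG)); apply.
apply/subsetP=> u; rewrite mem_fibre_ker // => /and3P[Gu1 Cu2 Ku].
apply/kerP.
  rewrite mem_fibre // Gu1 (subsetP (normal_sub nsCG)) //.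
  have [_ _ /proper_sub sKH _] := chief_factorP chKH.
  exact: (subsetP sKH).
by rewrite /= fE coset_id.
Qed.

Lemma residual_section_cent G K H :
  F_central F G K H -> residual F G \subset section_cent G K H.
Proof.
move=> FKH; have [nsKG nsHG _ _] := chief_factorP (F_central_chief FKH).
apply: residual_sub; first exact: section_cent_normal.
exact: F_central_cent.
Qed.

(** Modulo [K * K], which maps trivially to the semidirect product, the fibre
    product is a subdirect product of two copies of [G / K]. *)
Lemma chief_central_residual G K H :
  chief_factor G K H -> F (G / K)%G -> F_central F G K H.
Proof.
move=> chKH FGK; have [nsKG nsHG prKH _] := chief_factorP chKH.
have [f fE fG] := quotient_restr nsKG.
apply/(F_centralP chKH); apply/residual_subP => //; first exact: fibre_ker_normal.
have FfG: F (f @* G)%G by rewrite (group_inj fG).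
have s1: residual F (fibre G H) \subset 'ker (fibre_fst nsHG f).
  apply: residual_ker => //; by rewrite (group_inj (fibre_fst_im _ _)).
have s2: residual F (fibre G H) \subset 'ker (fibre_snd nsHG f).
  apply: residual_ker => //; by rewrite (group_inj (fibre_snd_im _ _)).
apply/subsetP=> u Ru; case/morphpreP: (subsetP s1 u Ru) => Wu /set1P /= u1.
case/morphpreP: (subsetP s2 u Ru) => _ /set1P /= u2; rewrite !fE in u1 u2.
rewrite mem_fibre // in Wu; case/and3P: Wu => Gu1 Gu2 Hu.
have nK := subsetP (normal_norm nsKG).
have{u1} Ku1: u.1 \in K by apply: coset_idr u1; apply: nK.
have{u2} Ku2: u.2 \in K by apply: coset_idr u2; apply: nK.
rewrite mem_fibre_ker // Gu1 groupM ?groupV //.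
by rewrite (subsetP (section_cent_sub nsKG nsHG)).
Qed.


Hypothesis satF : saturated F.

(** Saturation in relative form. *)
Lemma Frattini_ext G K H :
    K <| G -> H <| G -> K \subset H -> H / K \subset 'Phi(G / K) ->
    F (G / H)%G -> F (G / K)%G.
Proof.
move=> nsKG nsHG sKH sPhi FGH; apply: satF; apply: subset_trans sPhi.
apply: residual_sub; first exact: quotient_normal.
by apply: gclass_isog FGH => //; rewrite isog_sym; apply: third_isog.
Qed.

(** When [H / K] has a complement [M / K], the pairs [(x, m)] with [m] in [M]
    cover the semidirect product, and the first projection shows that the
    quotient of [G] by ['C_M(H / K)] is in [F]; that subgroup meets [H] in
    [K]. *)
Lemma F_central_ext G K H :
  F_central F G K H -> abelian (H / K) -> F (G / H)%G -> F (G / K)%G.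
Proof.
move=> FKH abHK FGH; have chKH := F_central_chief FKH.
have [nsKG nsHG prKH _] := chief_factorP chKH.
have [[nKG nHG] sHG] := (normal_norm nsKG, normal_norm nsHG, normal_sub nsHG).
have [sPhi | nPhi] := boolP (H / K \subset 'Phi(G / K)).
  by apply: Frattini_ext FGH => //; apply: proper_sub.
have [M [sKM sMG HMG HMK]] := chief_complement chKH abHK nPhi.
pose C := section_cent G K H; pose L := (C :&: M)%G.
have nsCG : C <| G by apply: section_cent_normal.
have sKC : K \subset C by apply: section_cent_sub.
have sHC : H \subset C by apply: abelian_section_cent.
have nsLG : L <| G.
  rewrite /normal subIset ?sMG ?orbT //= -{1}HMG mul_subG //; last first.
    by rewrite normsI ?normG // (subset_trans sMG) // normal_norm.
  apply/subsetP=> h Hh; rewrite inE; apply/subsetP=> _ /imsetP[x /setIP[Cx Mx] ->].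
  have Kc: [~ x, h] \in K.
    have [_ cx] := section_centP _ nsKG nsHG Cx.
    by rewrite -invg_comm groupV cx.
  rewrite conjg_mulR in_setI (groupM Mx (subsetP sKM _ Kc)) andbT.
  exact: (groupM (G := C) Cx (subsetP sKC _ Kc)).
have eqK : L :&: H = K.
  by rewrite /= -setIA [M :&: H]setIC HMK; apply/setIidPr.
suffices FGL : F (G / L)%G.
  apply/residual_subP => //; rewrite -eqK.
  by rewrite subsetI !residual_sub.
pose W' := (fibre G H :&: setX G M)%G.
have memW' u : (u \in W') = [&& u.1 \in G, u.2 \in M & u.2^-1 * u.1 \in H].
  case: u => x y; rewrite in_setI mem_fibre // in_setX /=.
  case: (x \in G) => //=; rewrite andbC andbA; congr (_ && _).
  by apply: andb_idr => /(subsetP sMG).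
have sW'W : W' \subset fibre G H by apply: subsetIl.
have nsN := fibre_ker_normal chKH; set N := fibre_ker G K H in nsN.
have defW : W' * N = fibre G H.
  apply/eqP; rewrite eqEsubset; apply/andP; split.
    by rewrite mul_subG // normal_sub.
  apply/subsetP=> -[x y]; rewrite mem_fibre //= => /and3P[Gx Gy Hyx].
  have: y^-1 \in H * M by rewrite HMG groupV.
  case/mulsgP=> h m Hh Mm def_y; have Gm := subsetP sMG m Mm.
  have Gh := subsetP sHG h Hh.
  have {}def_y: y = m^-1 * h^-1 by rewrite -invMg -def_y invgK.
  apply/mulsgP; exists (x * h, m^-1) (h^-1, h^-1).
  - rewrite memW' /= groupM // groupV Mm invgK mulgA groupM //=.
    move: Hyx; rewrite def_y invMg !invgK => Hhmx.
    by rewrite -(groupMl _ Hh) mulgA.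
  - rewrite mem_fibre_ker //= groupV Gh mulVg group1 andbT groupV.
    exact: (subsetP sHC).
  by rewrite def_y -[(x * h, _) * _]/(x * h * h^-1, m^-1 * h^-1) mulgK.
have FW' : F (W' / (W' :&: N))%G.
  have FW := (F_centralP chKH).1 FKH.
  apply: gclass_isog FW => //; rewrite isog_sym.
  have := weak_second_isog (subset_trans sW'W (normal_norm nsN)).
  by rewrite defW setIC.
have [f fE fG] := quotient_restr nsLG.
have nsN' := normalGI sW'W nsN.
have im1 : fibre_fst nsHG f @* W' = G / L.
  rewrite -fG; apply/eqP; rewrite eqEsubset; apply/andP; split; apply/subsetP=> z.
    case/morphimP=> u _; rewrite memW' => /and3P[Gu _ _] -> /=.
    exact: mem_morphim.
  case/morphimP=> x _; rewrite -{1}HMG => /mulsgP[h m Hh Mm ->] ->.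
  have Gm := subsetP sMG m Mm; have Gh := subsetP sHG h Hh.
  have Ww: (h * m, m) \in W'.
    by rewrite memW' /= groupM // Mm -conjgE memJ_norm // (subsetP nHG).
  by apply/morphimP; exists (h * m, m) => //; apply: (subsetP sW'W).
have := gclass_morphim clF formF (f := fibre_fst nsHG f) sW'W nsN' FW'.
rewrite (group_inj im1); apply; apply/subsetP=> u /setIP[Wu].
rewrite mem_fibre_ker // => /and3P[Gu1 Cu2 Ku].
apply/kerP; first exact: (subsetP sW'W).
have Mu2: u.2 \in M by move: Wu; rewrite memW' => /and3P[].
rewrite /= fE; apply: coset_id; rewrite -(mulKVg u.2 u.1) groupM //.
  exact/setIP.
by rewrite (subsetP (_ : K \subset L)) // -eqK subsetIl.
Qed.


(** The chief factors [H / (H :&: L)] and [HL / L] are [G]-isomorphic, so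
    they are [F]-central together. *)
Lemma F_central_perspective G H L :
    H <| G -> L <| G ->
  F_central F G (H :&: L)%G H <-> F_central F G L (H <*> L)%G.
Proof.
move=> nsHG nsLG.
suffices iso : chief_factor G (H :&: L)%G H ->
    fibre G H / fibre_ker G (H :&: L)%G H
      \isog fibre G (H <*> L)%G / fibre_ker G L (H <*> L)%G.
  split=> FHL; have ch := F_central_chief FHL.
    apply/F_centralP; first exact: chief_factor_up.
    by apply: (gclass_isog clF (iso ch)); apply/F_centralP.
  have ch' := chief_factor_down nsHG nsLG ch.
  apply/F_centralP => //; move/(F_centralP ch): FHL.
  by apply: gclass_isog => //; rewrite isog_sym; apply: iso.
move=> ch; have nsYG : (H <*> L)%G <| G by apply: normalY.
have nLH := subset_trans (normal_sub nsHG) (normal_norm nsLG).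
have nsN := fibre_ker_normal (chief_factor_up nsHG nsLG ch).
set W2 := fibre G (H <*> L)%G in nsN *; set N2 := fibre_ker G L _ in nsN *.
have sHY : H \subset H <*> L by apply: joing_subl.
have sW : fibre G H \subset W2.
  apply/subsetP=> u; rewrite !mem_fibre // => /and3P[-> -> Hu] /=.
  exact: (subsetP sHY).
have defW : fibre G H * N2 = W2.
  apply/eqP; rewrite eqEsubset; apply/andP; split.
    by rewrite mul_subG // normal_sub.
  apply/subsetP=> -[x y]; rewrite mem_fibre // => /and3P[/= Gx Gy Hyx].
  have: y^-1 * x \in H * L by rewrite -norm_joinEl.
  case/mulsgP=> h l Hh Ll eq_yx.
  have [Gh Gl] := (subsetP (normal_sub nsHG) h Hh, subsetP (normal_sub nsLG) l Ll).
  apply/mulsgP; exists (y * h, y) (l, 1).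
  - by rewrite mem_fibre //= groupM // Gy mulKg.
  - exact: fibre_ker_left.
  by rewrite -[(y * h, y) * _]/(y * h * l, y * 1) -mulgA -eq_yx mulKVg mulg1.
have eqN : N2 :&: fibre G H = fibre_ker G (H :&: L)%G H.
  have nsIG : (H :&: L)%G <| G by apply: normalI.
  apply/setP=> u; rewrite in_setI !mem_fibre_ker // mem_fibre //.
  rewrite -section_cent_perspective // [_ \in (H :&: L)%G]in_setI.
  apply/andP/and3P=> [[/and3P[Gu1 Cu2 Lu] /and3P[_ _ Hu]] | [Gu1 Cu2]].
    by split=> //; apply/andP.
  case/andP=> Hu Lu; split; apply/and3P; split=> //; by case/setIP: Cu2.
have := weak_second_isog (subset_trans sW (normal_norm nsN)).
by rewrite defW eqN.
Qed.

Hypothesis nilF :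
  forall (rT : finGroupType) (H : {group rT}), nilpotent H -> F H.

Lemma central_F_central G K H :
    chief_factor G K H -> abelian (H / K) -> G \subset section_cent G K H ->
  F_central F G K H.
Proof.
move=> chKH abHK sGC; exists chKH; apply/nilF/abelian_nil.
have eqC : G / section_cent G K H = 1.
  by apply/trivgP; rewrite quotient_sub1 // (subset_trans sGC) ?normG.
rewrite /= -(im_sdpair <[chief_acts chKH]>%gact).
by rewrite [X in _ * _ @* X]eqC morphim1 mulg1 morphim_abelian.
Qed.

End Central.

(** * Normal closures and cores *)

Section NormalClosure.

Variables (gT : finGroupType) (G : {group gT}).
Implicit Types A B : {group gT}.

Lemma sub_nclosure A : A \subset nclosure G A.
Proof. by apply: subset_trans (subset_gen _); rewrite sub_class_support. Qed.

Lemma nclosure_norm A : G \subset 'N(nclosure G A).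
Proof. by rewrite norms_gen // class_support_norm. Qed.

Lemma nclosure_min A B :
  A \subset B -> G \subset 'N(B) -> nclosure G A \subset B.
Proof. by move=> sAB nBG; rewrite gen_subG class_support_sub_norm. Qed.

Lemma nclosure_normal A : A \subset G -> nclosure G A <| G.
Proof. by move=> sAG; rewrite /normal nclosure_norm nclosure_min ?normG. Qed.

Lemma gcore_nclosure A : gcore A G \subset nclosure G A.
Proof. exact: subset_trans (gcore_sub A G) (sub_nclosure A). Qed.

Lemma gcore_id_norm A : A \subset gcore A G -> G \subset 'N(A).
Proof.
move=> sA; suffices <- : gcore A G = A by apply: gcore_norm.
by apply/eqP; rewrite eqEsubset gcore_sub.
Qed.

End NormalClosure.

(** * The residual is nilpotent *)

Section Main.

Variable F : gclass.
Hypothesis clF : is_gclass F.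
Hypothesis formF : formation F.
Hypothesis satF : saturated F.
Hypothesis normF : normally_hereditary F.
Hypothesis nilF :
  forall (rT : finGroupType) (H : {group rT}), nilpotent H -> F H.

Variables (gT : finGroupType) (G : {group gT}).
Implicit Types A B H K L M P Q R X Y : {group gT}.

Notation D := (residual F G).

Hypothesis solD : solvable D.
Hypothesis hL :
  forall A : {group gT}, L_class G F A -> L_Delta G (F_central F G) A.

Let nsDG : D <| G. Proof. exact: residual_normal. Qed.
Let sDG : D \subset G. Proof. exact: normal_sub. Qed.

Lemma F_central_between A K H :
    A \subset G -> F (nclosure G A / gcore A G)%G ->
    chief_factor G K H -> gcore A G \subset K -> H \subset nclosure G A ->
  F_central F G K H.
Proof.
move=> sAG FA chKH sAK sHA.
have [_ [eqA | [_ cA]]] : L_Delta G (F_central F G) A; try exact: hL.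
  have [_ _ prKH _] := chief_factorP chKH.
  case/negP: (proper_subn prKH); apply: subset_trans sAK.
  by rewrite eqA.
exact: cA.
Qed.

Lemma chief_abelem K H :
  chief_factor G K H -> H \subset D -> is_abelem (H / K).
Proof.
move=> chKH sHD; have minH := chief_factor_minnormal chKH.
by have [] := minnormal_solvable minH (subxx _) (quotient_sol _ (solvableS sHD solD)).
Qed.

Lemma chief_abelian K H :
  chief_factor G K H -> H \subset D -> abelian (H / K).
Proof.
move=> chKH sHD; have /is_abelemP[p _] := chief_abelem chKH sHD.
exact: abelem_abelian.
Qed.

(** A subgroup [A] that is not normal would have core [K] and normal closure
    [H], and [H / K] is nilpotent. *)
Lemma noncentral_norm K H A :
    chief_factor G K H -> H \subset D -> ~ F_central F G K H ->
    K \subset A -> A \subset H -> G \subset 'N(A).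
Proof.
move=> chKH sHD nFKH sKA sAH; have [nsKG nsHG prKH maxK] := chief_factorP chKH.
have [[nKG nHG] sHG] := (normal_norm nsKG, normal_norm nsHG, normal_sub nsHG).
apply: contra_notT nFKH => nAG.
have clA : nclosure G A :=: H.
  have [||||//] := maxK (nclosure G A).
  - exact: subset_trans sKA (sub_nclosure _ _).
  - exact: nclosure_min.
  - exact: nclosure_norm.
  move=> eqK; case/negP: nAG; suffices -> : A :=: K by [].
  by apply/eqP; rewrite eqEsubset sKA -eqK sub_nclosure.
have coA : gcore A G :=: K.
  have [|||//|] := maxK (gcore A G)%G.
  - exact: gcore_max.
  - exact: subset_trans (gcore_sub _ _) sAH.
  - exact: gcore_norm.
  move=> eqH; case/negP: nAG; apply: gcore_id_norm.
  by rewrite /= in eqH; rewrite eqH.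
apply: (@F_central_between A) => //; first exact: subset_trans sAH sHG.
- apply/nilF/abelian_nil; rewrite /= -[generated _]/(gval (nclosure G A)) clA.
  rewrite (coA : gcore A G = K); exact: chief_abelian.
- by rewrite (coA : gcore A G = K).
by rewrite clA.
Qed.

Lemma noncentral_cyclic K H :
  chief_factor G K H -> H \subset D -> ~ F_central F G K H -> cyclic (H / K).
Proof.
move=> chKH sHD nFKH; apply: (chief_factor_cyclic chKH) => A sKA sAH.
exact: noncentral_norm chKH sHD nFKH sKA sAH.
Qed.

Lemma residual_centralises_chief K H :
  chief_factor G K H -> H \subset D -> D \subset section_cent G K H.
Proof.
move=> chKH sHD; have [nsKG nsHG prKH maxK] := chief_factorP chKH.
have [FKH | nFKH] := pselect (F_central F G K H).
  exact: residual_section_cent.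
have cycH := noncentral_cyclic chKH sHD nFKH.
apply: residual_sub; first exact: section_cent_normal.
apply/nilF/abelian_nil/sub_der1_abelian.
have nK'G : G^`(1) \subset 'N(K).
  exact: subset_trans (der_sub 1 G) (normal_norm nsKG).
rewrite subsetI der_sub /= sub_astabQ nK'G /= quotient_der ?normal_norm //.
have nHG' : G / K \subset 'N(H / K) by rewrite quotient_norms ?normal_norm.
have nHG'' : (G / K)^`(1) \subset 'N(H / K).
  exact: subset_trans (der_sub 1 _) nHG'.
rewrite -ker_conj_aut -sub_morphim_pre //.
apply/trivgP => /=.
rewrite morphim_der //; apply/commG1P.
exact: abelianS (Aut_conj_aut _ _) (Aut_cyclic_abelian cycH).
Qed.

Lemma residual_nilpotent : nilpotent D.
Proof.
apply/forall_inP=> X /subsetIP[sXD sXR].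
have sXG := subset_trans sXD sDG.
set Y := nclosure G X; have nsYG : Y <| G by apply: nclosure_normal.
have sYD : Y \subset D by apply: nclosure_min => //; apply: normal_norm.
have sYR : Y \subset [~: Y, D].
  apply: nclosure_min; first by apply: subset_trans sXR _; rewrite commSg ?sub_nclosure.
  by rewrite normsR // normal_norm.
rewrite -subG1 (subset_trans (sub_nclosure G X)) // -/Y.
have [-> // | ntY] := eqVneq Y 1%G.
have [K maxK] : {K : {group gT} | maxnormal K Y G}.
  by apply: ex_maxgroup; exists 1%G; rewrite proper1G ntY norms1.
have chK : chief_factor G K Y by rewrite /chief_factor maxK.
have [nsKG _ prKY _] := chief_factorP chK.
case/negP: (proper_subn prKY); apply: subset_trans sYR _.
rewrite gen_subG; apply/subsetP=> _ /imset2P[y d Yy Dd ->].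
have Cd := subsetP (residual_centralises_chief chK sYD) d Dd.
by have [_ ->] := section_centP _ nsKG nsYG Cd.
Qed.

(** Otherwise [G / R] would be in [F]. *)
Lemma top_noncentral R : chief_factor G R D -> ~ F_central F G R D.
Proof.
move=> chR FR; have [nsRG _ prRD _] := chief_factorP chR.
case/negP: (proper_subn prRD); apply: residual_sub => //.
apply: (F_central_ext clF formF satF FR); first exact: chief_abelian.
exact: residual_quotient.
Qed.

(** If the core of [A] were in [R], then [D / R] would be perspective to a
    chief factor between the core and the normal closure of [A]. *)
Lemma gcore_top R A :
  chief_factor G R D -> A \subset D -> ~~ (A \subset R) ->
  ~~ (gcore A G \subset R).
Proof.
move=> chR sAD nAR; apply/negP=> sAR; have [nsRG _ prRD maxR] := chief_factorP chR.
have sAG := subset_trans sAD sDG.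
set B := nclosure G A; have nsBG : B <| G by apply: nclosure_normal.
have sBD : B \subset D by apply: nclosure_min => //; apply: normal_norm.
have eqBR : (B <*> R)%G = D.
  apply/group_inj; have [||| eqR | //] := maxR (B <*> R)%G.
  - exact: joing_subr.
  - by rewrite join_subG sBD proper_sub.
  - by rewrite normsY ?normal_norm.
  case/negP: nAR; rewrite -eqR; apply: subset_trans (sub_nclosure G A) _.
  exact: joing_subl.
apply: (top_noncentral chR); rewrite -eqBR; apply/(F_central_perspective clF nsBG nsRG).
apply: (@F_central_between A) => //; rewrite ?subsetIl //.
- apply/nilF/quotient_nil; apply: nilpotentS residual_nilpotent.
  exact: sBD.
- by apply: chief_factor_down; rewrite // eqBR.
by rewrite subsetI gcore_nclosure.
Qed.


(** * Top chief factors and the Sylow subgroups of the residual *)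

Section TopFactor.

Variables (p : nat) (R : {group gT}).
Hypothesis chR : chief_factor G R D.
Hypothesis sQR : 'O_p^'(D) \subset R.

Notation P := 'O_p(D).

Let nsRG : R <| G. Proof. by have [] := chief_factorP chR. Qed.
Let prRD : R \proper D. Proof. by have [] := chief_factorP chR. Qed.
Let nRG : G \subset 'N(R). Proof. exact: normal_norm. Qed.
Let nRD : D \subset 'N(R). Proof. exact: subset_trans sDG nRG. Qed.
Let sPD : P \subset D. Proof. exact: pcore_sub. Qed.

Lemma top_ntriv : D / R != 1.
Proof. by rewrite -subG1 quotient_sub1 ?proper_subn. Qed.

Lemma top_abelem : p.-abelem (D / R).
Proof.
rewrite -is_abelem_pgroup; first exact: chief_abelem.
have /= defD := dprodW (nilpotent_pcoreC p residual_nilpotent).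
rewrite /= -{1}defD quotientMl ?(subset_trans sPD) //.
have /trivgP-> : 'O_p^'(D) / R \subset 1%G.
  by rewrite quotient_sub1 // (subset_trans (pcore_sub _ _)).
by rewrite mulg1 quotient_pgroup // pcore_pgroup.
Qed.

Lemma top_card : #|D / R| = p.
Proof.
apply: cyclic_abelem_prime top_abelem _ top_ntriv.
by apply: noncentral_cyclic => //; apply: top_noncentral.
Qed.

Lemma top_prime : prime p.
Proof. by have [] := pgroup_pdiv (abelem_pgroup top_abelem) top_ntriv. Qed.

Lemma pcore_not_sub_top : ~~ (P \subset R).
Proof.
apply/negP=> sPR; case/negP: (proper_subn prRD).
rewrite -(dprodW (nilpotent_pcoreC p residual_nilpotent)).
by rewrite mul_subG.
Qed.

Lemma top_cycle v : v \in D -> v \notin R -> <[coset R v]> = D / R.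
Proof.
move=> Dv Rv; have Nv := subsetP nRD v Dv.
have sv : <[coset R v]> \subset D / R by rewrite cycle_subG mem_quotient.
apply/eqP; rewrite eqEcard sv /= top_card -orderE.
have: #[coset R v] %| p by rewrite -top_card; apply: cardSg sv.
case/primeP: top_prime => _ dv /dv/orP[|/eqP->//].
by rewrite order_eq1 => /eqP/(coset_idr Nv) Rv'; rewrite Rv' in Rv.
Qed.

Lemma top_expg v k : v \in D -> v \notin R -> (v ^+ k \in R) = (p %| k).
Proof.
move=> Dv Rv; have Nv := subsetP nRD v Dv.
rewrite -top_card -(top_cycle Dv Rv) -orderE order_dvdn -morphX //=.
by apply/idP/eqP=> [/coset_id // | /coset_idr -> //]; rewrite groupX.
Qed.

(** The core of [<[a]>] has an element outside [R]; it is a power of [a] with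
    exponent prime to [p], hence a generator. *)
Lemma top_cycle_norm a : a \in P -> a \notin R -> G \subset 'N(<[a]>).
Proof.
move=> Pa Ra; have Da := subsetP sPD a Pa.
have [||] := subsetPn (gcore_top (A := <[a]>%G) chR _ _).
- by rewrite cycle_subG.
- by rewrite cycle_subG.
move=> c Ac Rc; have /cycleP[k def_c] := subsetP (gcore_sub _ _) c Ac.
apply: gcore_id_norm => /=.
suffices /eqP eq_ac : generator <[a]> c by rewrite {1}eq_ac cycle_subG.
rewrite def_c generator_coprime.
have [m ->] := p_natP (mem_p_elt (pcore_pgroup p D) Pa).
rewrite coprimeXl // prime_coprime ?top_prime //.
by rewrite -(top_expg _ Da Ra) -def_c.
Qed.

(** Otherwise [G] would centralise [D / R], a central chief factor.  An element
    acting nontrivially on [D / R] centralises no nontrivial element of it, as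
    this factor has prime order. *)
Lemma top_moved :
  exists2 g, g \in G & forall v, v \in D -> v \notin R -> [~ v, g] \notin R.
Proof.
have /subsetPn[g Gg Cg] : ~~ (G \subset section_cent G R D).
  apply/negP=> sGC; apply: (top_noncentral chR).
  by apply: central_F_central => //; apply: chief_abelian.
exists g => // v Dv Rv; apply: contra Cg => Rvg.
have [Nv Ng] := (subsetP nRD v Dv, subsetP nRG g Gg).
apply/section_centP => //; split=> // h Dh; have Nh := subsetP nRD h Dh.
have: coset R h \in <[coset R v]> by rewrite top_cycle ?mem_quotient.
case/cycleP=> k def_h; apply: coset_idr; first by rewrite groupR.
have cvg : commute (coset R v) (coset R g).
  by apply/commgP; rewrite -morphR //= coset_id.
rewrite morphR //= def_h; apply/eqP/commgP/commute_sym/commuteX.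
exact: commute_sym.
Qed.

(** The commutator [c] of [u] and [v] lies in both normal cyclic groups.  With
    [u ^ g = u ^+ n] and [v ^ g = v ^+ m.+1], [g] raises [c] to the powers [n]
    and [n * m.+1], so [c ^+ (n * m) = 1], where [n] and [m] are prime to
    [p]. *)
Lemma top_commute u v :
  u \in P -> u \notin R -> v \in P -> v \notin R -> commute u v.
Proof.
move=> Pu Ru Pv Rv; have [g Gg mv_g] := top_moved.
have [Du Dv] := (subsetP sPD u Pu, subsetP sPD v Pv).
have [Gu Gv] := (subsetP sDG u Du, subsetP sDG v Dv).
have nu := subsetP (top_cycle_norm Pu Ru); have nv := subsetP (top_cycle_norm Pv Rv).
set c := [~ u, v].
have uc : c \in <[u]>.
  by rewrite /c commgEl groupM ?groupV ?cycle_id // memJ_norm ?cycle_id ?nu.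
have vc : c \in <[v]>.
  by rewrite /c commgEr groupM ?cycle_id // memJ_norm ?groupV ?cycle_id ?nv.
have cuc : commute u c by have /cycleP[i ->] := uc; apply: commuteX.
have cvc : commute v c by have /cycleP[i ->] := vc; apply: commuteX.
have /cycleP[m def_m] : [~ v, g] \in <[v]>.
  by rewrite commgEl groupM ?groupV ?cycle_id // memJ_norm ?cycle_id ?nv.
have /cycleP[n def_n] : u ^ g \in <[u]> by rewrite memJ_norm ?cycle_id ?nu.
have p_m : ~~ (p %| m) by rewrite -(top_expg _ Dv Rv) -def_m mv_g.
have p_n : ~~ (p %| n).
  by rewrite -(top_expg _ Du Ru) -def_n memJ_norm ?(subsetP nRG).
have def_vg : v ^ g = v ^+ m.+1 by rewrite conjg_mulR def_m expgS.
have cg1 : c ^ g = c ^+ (n * m.+1).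
  by rewrite /c conjRg def_n def_vg commXXg.
have cg2 : c ^ g = c ^+ n.
  by have /cycleP[j ->] := uc; rewrite conjXg def_n -!expgM mulnC.
have: c ^+ (n * m) == 1.
  by rewrite -(inj_eq (mulgI (c ^+ n))) -expgD -mulnS -cg1 cg2 mulg1.
rewrite -order_dvdn => dv_c; apply/commgP; rewrite -/c -order_eq1.
have Pc : c \in P by rewrite (subsetP _ _ uc) // cycle_subG.
have [k ok] := p_natP (mem_p_elt (pcore_pgroup p D) Pc).
rewrite ok in dv_c *; case: k dv_c {ok} => // k dv_c.
have: p %| n * m by apply: dvdn_trans dv_c; rewrite expnS dvdn_mulr.
by rewrite Euclid_dvdM ?top_prime // (negPf p_n) (negPf p_m).
Qed.

Lemma pcore_abelian : abelian P.
Proof.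
have [v Pv Rv] := subsetPn pcore_not_sub_top.
have cRR w : w \in P -> w \notin R -> w \in 'C(P).
  move=> Pw Rw; apply/centP=> z Pz; have [Rz | Rz] := boolP (z \in R).
    rewrite -(mulgKV w z); apply: commuteM; last exact: commute_refl.
    apply: top_commute => //; first by rewrite groupM ?groupV.
    by rewrite groupMl // groupV.
  exact: top_commute.
apply/subsetP=> w Pw; have [Rw | Rw] := boolP (w \in R); last exact: cRR.
rewrite -(mulgKV v w); apply: groupM; last exact: cRR.
apply: cRR; first by rewrite groupM ?groupV.
by rewrite groupMl // groupV.
Qed.

Lemma top_odd : odd p.
Proof.
have [v Pv Rv] := subsetPn pcore_not_sub_top.
have Dv := subsetP sPD v Pv; have [g Gg mv_g] := top_moved.
have [p2 | //] := even_prime top_prime.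
have /cycleP[m def_m] : [~ v, g] \in <[v]>.
  rewrite commgEl groupM ?groupV ?cycle_id // memJ_norm ?cycle_id //.
  by rewrite (subsetP (top_cycle_norm Pv Rv)).
have := mv_g v Dv Rv; rewrite def_m top_expg // => p_m.
have: v ^ g \notin R by rewrite memJ_norm // (subsetP nRG).
rewrite conjg_mulR def_m -expgS top_expg // p2 !dvdn2 /= negbK.
by move: p_m; rewrite p2 dvdn2 negbK => ->.
Qed.

(** Modulo [p]-th powers, the elements of [G] act on [P] as scalars: for [w] in
    [R] and [v] in [P] outside [R], both [<[v]>] and [<[v * w]>] are normal, and
    the two exponents agree modulo [p]. *)
Lemma Phi_sub_norm (S : {group gT}) :
  'Phi(P) \subset S -> S \subset P -> G \subset 'N(S).
Proof.
move=> sPhiS sSP; have [v Pv Rv] := subsetPn pcore_not_sub_top.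
have Dv := subsetP sPD v Pv; have cPP := pcore_abelian.
have inS z k : z \in P -> p %| k -> z ^+ k \in S.
  move=> Pz /dvdnP[q ->]; apply: (subsetP sPhiS).
  have PhiE : 'Phi(P) = 'Mho^1(P) by apply: (Phi_Mho (pcore_pgroup p D)).
  rewrite PhiE mulnC expgM groupX //.
  by have := Mho_p_elt 1 Pz (mem_p_elt (pcore_pgroup p D) Pz); rewrite expn1.
apply/subsetP=> g Gg; rewrite inE; apply/subsetP=> _ /imsetP[w Sw ->].
have Pw := subsetP sSP w Sw; have Dw := subsetP sPD w Pw.
have nrm a : a \in P -> a \notin R -> exists k, a ^ g = a ^+ k.
  move=> Pa Ra; apply/cycleP; rewrite memJ_norm ?cycle_id //.
  by rewrite (subsetP (top_cycle_norm Pa Ra)).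
have [Rw | Rw] := boolP (w \in R); last first.
  by have [k ->] := nrm w Pw Rw; rewrite groupX.
have [m def_m] := nrm v Pv Rv.
have [||n def_n] := nrm (v * w); [by rewrite groupM | by rewrite groupMr |].
have cvw : commute v w by apply: (centsP cPP).
have eq1 : v ^+ m * w ^ g = v ^+ n * w ^+ n.
  by rewrite -expgMn // -def_n conjMg def_m.
have ng := subsetP nRG g Gg.
have Rwg : w ^ g \in R by rewrite memJ_norm.
have eq2 : w ^ g = v ^- m * v ^+ n * w ^+ n.
  by rewrite -mulgA -eq1 mulKg.
have Rmn : v ^- m * v ^+ n \in R.
  by rewrite -(groupMr _ (groupX n Rw)) -eq2.
rewrite eq2 groupM ?groupX // {eq2}.
have [le_mn | /ltnW le_nm] := leqP m n.
  move: Rmn; rewrite -(subnK le_mn) addnC expgD mulKg top_expg //.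
  exact: inS.
move: Rmn; rewrite -(subnK le_nm) addnC expgD invMg mulgKV groupV top_expg //.
by rewrite groupV; apply: inS.
Qed.

End TopFactor.


Lemma pcore_residual_norm pi : G \subset 'N('O_pi(D)).
Proof. exact: char_norm_trans (pcore_char pi D) (normal_norm nsDG). Qed.

Lemma top_exists (p : nat) : 'O_p(D) != 1 ->
  exists2 R : {group gT}, chief_factor G R D & 'O_p^'(D) \subset R.
Proof.
move=> ntP; have [|R maxR sQR] :=
  @maxgroup_exists _
    [pred X : {group gT} | (X \proper D) && (G \subset 'N(X))] 'O_p^'(D)%G.
- rewrite /= pcore_residual_norm andbT properEneq pcore_sub andbT.
  apply: contraNneq ntP => eqQ; rewrite -subG1.
  have /dprodP[_ _ _ <-] := nilpotent_pcoreC p residual_nilpotent.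
  by rewrite eqQ subsetI subxx pcore_sub.
by exists R => //; rewrite /chief_factor nsDG andbT.
Qed.

Section PCore.

Variable p : nat.
Notation P := 'O_p(D)%G.
Notation Q := 'O_p^'(D)%G.

(** Outside the Frattini subgroup, [w] avoids some maximal subgroup of [P],
    which yields a top chief factor.  Inside it, [w] is a [p]-th power, and the
    order of the root is larger. *)
Lemma pcore_cycle_norm w : w \in P -> G \subset 'N(<[w]>).
Proof.
move=> Pw.
have [P1 | ntP] := eqVneq (P : {set gT}) 1.
  by move: Pw; rewrite /= P1 => /set1P->; rewrite cycle1 norms1.
have [R chR sQR] := top_exists ntP.
have p_pr := top_prime chR sQR.
have cPP : abelian P := pcore_abelian chR sQR.
have pP : p.-group P := pcore_pgroup p D.
have defD : P * Q = D := dprodW (nilpotent_pcoreC p residual_nilpotent).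
have tiPQ : P :&: Q = 1 by have /dprodP[] := nilpotent_pcoreC p residual_nilpotent.
have nsQG : 'O_p^'(D)%G <| G.
  by rewrite /normal pcore_residual_norm (subset_trans (pcore_sub _ _)).
have [n] := ubnP (#|P| - #[w]); elim: n => // n IHn in w Pw *; rewrite ltnS => le_n.
have [Phiw | Phiw] := boolP (w \in 'Phi(P)).
  have [-> | ntw] := eqVneq w 1; first by rewrite cycle1 norms1.
  have PhiE : 'Phi(P) = 'Mho^1(P) by apply: (Phi_Mho pP).
  have := Phiw; rewrite PhiE (MhoEabelian 1 pP) // expn1 => /imsetP[u Pu def_w].
  have ntu : u != 1 by apply: contraNneq ntw => u1; rewrite def_w u1 expg1n.
  have p_u : p %| #[u].
    have [[|k] ou] := p_natP (mem_p_elt pP Pu); last by rewrite ou expnS dvdn_mulr.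
    by rewrite -order_eq1 ou in ntu.
  have lt_wu : #[w] < #[u].
    by rewrite def_w orderXdiv // ltn_Pdiv ?order_gt0 ?prime_gt1.
  have le_uP : #[u] <= #|P| by rewrite subset_leq_card ?cycle_subG.
  have nuG : G \subset 'N(<[u]>).
    apply: IHn => //; apply: leq_trans le_n.
    by rewrite ltn_sub2l // (leq_trans lt_wu).
  apply: char_norm_trans nuG; apply: cycle_subgroup_char.
  by rewrite cycle_subG def_w groupX ?cycle_id.
have [M maxM wM] : exists2 M : {group gT}, maximal_eq M P & w \notin M.
  have [M /andP[maxM wM] | noM] :=
    pickP [pred M : {group gT} | maximal_eq M P && (w \notin M)]; first by exists M.
  case/negP: Phiw; apply/bigcapP=> M maxM; apply: contraFT (noM M) => wM /=.
  by rewrite maxM.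
have {}maxM : maximal M P.
  by case/orP: maxM => // /eqP eqM; rewrite eqM Pw in wM.
have sMP : M \subset P by have /proper_sub := maxgroupp maxM.
have nMG : G \subset 'N(M).
  apply: (Phi_sub_norm chR sQR) => //; exact: Phi_sub_max.
have sPD : P \subset D by apply: pcore_sub.
have sQD : Q \subset D by apply: pcore_sub.
have nsMG : M <| G by rewrite /normal nMG (subset_trans sMP) ?(subset_trans sPD).
have nQM : M \subset 'N(Q).
  exact: subset_trans (normal_sub nsMG) (normal_norm nsQG).
set R1 := (M <*> 'O_p^'(D))%G.
have wR1 : w \notin R1.
  apply: contra wM; rewrite /R1 /= norm_joinEl // => MQw.
  have: w \in M * Q :&: P by rewrite inE MQw.
  by rewrite -group_modl // [Q :&: P]setIC tiPQ mulg1.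
have sR1D : R1 \subset D by rewrite join_subG (subset_trans sMP).
apply: (top_cycle_norm (R := R1) (p := p) _ _ Pw wR1); last exact: joing_subr.
apply: chief_factorI => //; first exact: normalY.
  rewrite properEneq sR1D andbT; apply: contraNneq wR1 => ->.
  exact: (subsetP sPD).
move=> X sR1X sXD nXG; have [sMX sQX] : M \subset X /\ Q \subset X.
  by apply/andP; rewrite -join_subG.
have eqX : (X :&: P) * Q = X by rewrite group_modr // defD; apply/setIidPl.
have [eqI | ltI] := eqVproper (subsetIr X P).
  by right; rewrite -eqX eqI defD.
have eqM : X :&: P = M.
  have [_ maxMP] := maxgroupP maxM.
  by apply: (maxMP (X :&: P)%G) => //; rewrite subsetI sMX.
by left; rewrite -eqX eqM /R1 /= norm_joinEl.
Qed.

End PCore.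

Lemma residual_pcore_central (p : nat) : 'O_p(D) \subset 'C(D).
Proof.
have [-> | ntP] := eqVneq 'O_p(D) 1; first exact: sub1G.
have [R chR sQR] := top_exists ntP.
have /dprodP[_ defD cPQ _] := nilpotent_pcoreC p residual_nilpotent.
suffices: 'O_p(D) \subset 'C('O_p(D) * 'O_p^'(D)) by rewrite defD.
rewrite centM subsetI; apply/andP; split; first exact: pcore_abelian chR sQR.
by rewrite centsC.
Qed.

Lemma residual_constt (p : nat) x : x \in D -> x.`_p \in 'O_p(D).
Proof.
move=> Dx; rewrite (mem_normal_Hall (nilpotent_pcore_Hall p residual_nilpotent)).
- exact: p_elt_constt.
- exact: pcore_normal.
exact: groupX.
Qed.

Lemma residual_abelian : abelian D.
Proof.
apply/subsetP=> x Dx; rewrite -(prod_constt x); apply: group_prod => p _.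
exact: (subsetP (residual_pcore_central p)) (residual_constt p Dx).
Qed.

Lemma residual_subgroup_norm B : B \subset D -> G \subset 'N(B).
Proof.
move=> sBD; apply/subsetP=> g Gg; rewrite inE; apply/subsetP=> _ /imsetP[b Bb ->].
have Db := subsetP sBD b Bb.
rewrite -(prod_constt b) (big_morph (conjg^~ g) (fun x y => conjMg x y g) (conj1g g)).
apply: group_prod => p _.
have sbB : <[b.`_p]> \subset B by rewrite cycle_subG groupX.
apply: (subsetP sbB); rewrite memJ_norm ?cycle_id //.
exact: (subsetP (pcore_cycle_norm (residual_constt p Db))).
Qed.

Lemma pcore_ntriv p : prime p -> p %| #|D| -> 'O_p(D) != 1.
Proof.
move=> p_pr pD; rewrite trivg_card1.
rewrite (card_Hall (nilpotent_pcore_Hall p residual_nilpotent)).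
by rewrite neq_ltn p_part_gt1 mem_primes p_pr pD cardG_gt0 orbT.
Qed.

Lemma residual_odd : odd #|D|.
Proof.
apply: contraT => evD; have p2 : 2 %| #|D| by rewrite dvdn2.
have [R chR sQR] := top_exists (pcore_ntriv (isT : prime 2) p2).
by have := top_odd chR sQR.
Qed.


(** * The residual is a Hall subgroup *)

Section HallProperty.

Variables (p : nat) (R : {group gT}).
Hypothesis chR : chief_factor G R D.
Hypothesis sQR : 'O_p^'(D) \subset R.

Let nsRG : R <| G. Proof. by have [] := chief_factorP chR. Qed.
Let prRD : R \proper D. Proof. by have [] := chief_factorP chR. Qed.
Let nRG : G \subset 'N(R). Proof. exact: normal_norm. Qed.
Let nRD : D \subset 'N(R). Proof. exact: subset_trans sDG nRG. Qed.
Let abDR : abelian (D / R). Proof. exact: chief_abelian. Qed.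
Let nFR : ~ F_central F G R D. Proof. exact: top_noncentral. Qed.

Notation C := (section_cent G R D).

Let nsCG : C <| G. Proof. exact: section_cent_normal. Qed.
Let sDC : D \subset C. Proof. exact: residual_centralises_chief. Qed.
Let sRC : R \subset C. Proof. exact: subset_trans (proper_sub prRD) sDC. Qed.

(** [D / R] is central in [C / R], and [C / D] is normal in [G / D]. *)
Lemma top_cent_quotient : F (C / R)%G.
Proof.
have sCG := normal_sub nsCG.
have nsDC : D <| C by apply: normalS sDC sCG nsDG.
have nsRC : R <| C by apply: normalS sRC sCG nsRG.
have FCD : F (C / D)%G.
  by apply: normF (residual_quotient clF formF G); apply: quotient_normal.
have [_ _ _ maxR] := chief_factorP chR.
apply: (F_central_ext clF formF satF _ abDR FCD).
apply: central_F_central => //.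
  apply: chief_factorI => // X sRX sXD _; apply: maxR => //.
  exact: residual_subgroup_norm.
apply/subsetP=> x Cx; apply/section_centP => //; split=> // h Dh.
by have [_ ->] := section_centP _ nsRG nsDG Cx.
Qed.

(** The normal closure of [A] is normal in [C], and [C / R] is in [F]. *)
Lemma between_class A :
  R \subset A -> A \subset C -> F (nclosure G A / gcore A G)%G.
Proof.
move=> sRA sAC; have sCG := normal_sub nsCG.
have sAG := subset_trans sAC sCG.
set B := nclosure G A; have nsBG : B <| G by apply: nclosure_normal.
have sBC : B \subset C by apply: nclosure_min => //; apply: normal_norm.
have sRB : R \subset B := subset_trans sRA (sub_nclosure G A).
have nsRB : R <| B by apply: normalS sRB (normal_sub nsBG) nsRG.
have FBR : F (B / R)%G.
  apply: normF top_cent_quotient; apply: quotient_normal.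
  exact: normalS sBC sCG nsBG.
apply/(residual_subP clF formF).
  apply: normalS (gcore_nclosure G A) (normal_sub nsBG) _.
  exact: gcore_normal.
apply: subset_trans (residual_sub nsRB FBR) _.
exact: gcore_max.
Qed.

(** Otherwise [D / R] would be perspective to a chief factor lying between
    the core and the normal closure of [A]. *)
Lemma nclosure_TI A :
  R \subset A -> A \subset C -> D :&: A = R -> D :&: nclosure G A = R.
Proof.
move=> sRA sAC tiDA; have sAG := subset_trans sAC (normal_sub nsCG).
have [_ _ _ maxR] := chief_factorP chR.
have nsBG : nclosure G A <| G by apply: nclosure_normal.
have sRB : R \subset nclosure G A := subset_trans sRA (sub_nclosure G A).
have [||| //|eqD] := maxR (D :&: nclosure G A)%G.
- by rewrite subsetI proper_sub.
- exact: subsetIl.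
- by rewrite normsI // normal_norm.
have sDB : D \subset nclosure G A by rewrite -eqD subsetIr.
have nsA0G : (gcore A G)%G <| G by apply: gcore_normal.
have eqR : (D :&: gcore A G)%G = R.
  apply/group_inj/eqP; rewrite eqEsubset -{1}tiDA setIS ?gcore_sub //=.
  by rewrite subsetI proper_sub //= gcore_max.
case: nFR; rewrite -{1}eqR; apply/(F_central_perspective clF nsDG nsA0G).
apply: (F_central_between sAG); first exact: between_class.
- by apply: chief_factor_up; rewrite // eqR.
- exact: subxx.
by rewrite join_subG sDB gcore_nclosure.
Qed.

(** Modulo [R], [a] generates a group of order [p] that is not in [D / R]. *)
Lemma top_order_TI a :
  a \in C -> a \notin D -> a ^+ p \in R -> D :&: (<[a]> <*> R) = R.
Proof.
move=> Ca Da Ra; have p_pr := top_prime chR sQR.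
have Ga := subsetP (normal_sub nsCG) a Ca.
have Na := subsetP nRG a Ga.
have nRa : <[a]> \subset 'N(R) by rewrite cycle_subG.
have sRD := proper_sub prRD.
have oa : #[coset R a] = p.
  have: #[coset R a] %| p by rewrite order_dvdn -morphX //= coset_id.
  case/primeP: p_pr => _ dv /dv/orP[|/eqP->//].
  rewrite order_eq1 => /eqP/(coset_idr Na) Ra'.
  by rewrite (subsetP sRD) in Da.
apply/eqP; rewrite eqEsubset subsetI sRD joing_subr !andbT.
rewrite -quotient_sub1; last by rewrite subIset // nRD.
apply: subset_trans (quotientI _ _ _) _.
rewrite quotientYidr // quotient_cycle // setIC prime_TIg //.
  by rewrite -orderE oa.
rewrite cycle_subG; apply: contra Da => /morphimP[d Nd Dd /= eq_ad].
have: a \in coset R @*^-1 (D / R).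
  by apply/morphpreP; split; rewrite //= eq_ad mem_quotient.
by rewrite quotientGK // (normalS sRD sDG).
Qed.

Lemma top_coprime_index : ~~ (p %| #|G : D|).
Proof.
apply/negP=> p_dv; have p_pr := top_prime chR sQR.
have [sRD [b Db Rb]] := properP prRD.
have nPhi : ~~ (D / R \subset 'Phi(G / R)).
  apply/negP=> sPhi; case/negP: (proper_subn prRD); apply: residual_sub => //.
  exact: (Frattini_ext clF satF nsRG nsDG sRD sPhi (residual_quotient clF formF G)).
have [M [sRM sMG defG tiDM]] := chief_complement chR abDR nPhi.
(* The complement has order divisible by p, whence an element of order p. *)
have [x Mx ox] : {x | x \in M / R & #[x] = p}.
  apply: Cauchy => //; rewrite card_quotient ?(subset_trans sMG) //.
  by rewrite -tiDM setIC indexgI -(indexMg D) defG.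
have {x Mx ox} [a Ma oa] : exists2 a, a \in M & #[coset R a] = p.
  by case/morphimP: Mx => a _ Ma def_x; exists a; rewrite -?def_x.
have [Ga Gb] := (subsetP sMG a Ma, subsetP sDG b Db).
have [Na Nb] := (subsetP nRG a Ga, subsetP nRG b Gb).
have Rap : a ^+ p \in R.
  by apply: coset_idr; rewrite ?groupX // morphX //= -oa expg_order.
have Da : a \notin D.
  apply/negP=> Da; have Ra : a \in R by rewrite -tiDM inE Da.
  by move: p_pr; rewrite -oa /= (coset_id Ra) order1.
(* As a normal subgroup of order p of a p-group, D / R is centralised by a. *)
have cab : coset R a \in 'C(D / R).
  have nXD : <[coset R a]> \subset 'N(D / R).
    by rewrite cycle_subG (subsetP (quotient_norms R (normal_norm nsDG))) ?mem_quotient.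
  pose X := (D / R <*> <[coset R a]>)%G.
  have pX : p.-group X.
    rewrite /X /= norm_joinEr // pgroupM (abelem_pgroup (top_abelem chR sQR)) /=.
    by rewrite /pgroup -orderE oa pnat_id.
  have nsX : D / R <| X.
    by rewrite /normal joing_subl join_subG normG.
  have sZ : D / R \subset 'Z(X).
    apply: prime_meetG; first by rewrite (top_card chR sQR).
    exact: meet_center_nil (pgroup_nil pX) nsX (top_ntriv chR).
  have := subset_trans sZ (subsetIr _ _); rewrite centsC; move/subsetP; apply.
  by rewrite mem_gen // inE cycle_id orbT.
have Ca : a \in C.
  by rewrite /section_cent /= in_setI Ga astabQ; apply/morphpreP.
have Cb := subsetP sDC b Db.
have Dab : a * b \notin D by rewrite groupMr.
have Rabp : (a * b) ^+ p \in R.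
  apply: coset_idr; first by rewrite groupX ?groupM.
  rewrite morphX ?groupM // morphM //= expgMn; last first.
    by apply: (centP cab); rewrite mem_quotient.
  by rewrite -!morphX //= !coset_id ?mulg1 // (top_expg chR sQR).
have sAC u : u \in C -> <[u]> <*> R \subset C.
  by move=> Cu; rewrite join_subG cycle_subG Cu.
have ti1 := nclosure_TI (joing_subr _ _) (sAC a Ca) (top_order_TI Ca Da Rap).
have ti2 := nclosure_TI (joing_subr _ _) (sAC _ (groupM Ca Cb))
              (top_order_TI (groupM Ca Cb) Dab Rabp).
set A1 := (<[a]> <*> R)%G in ti1; set A2 := (<[a * b]> <*> R)%G in ti2.
set B1 := nclosure G A1 in ti1; set B2 := nclosure G A2 in ti2.
have sA1G : A1 \subset G by rewrite join_subG cycle_subG Ga normal_sub.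
have sA2G : A2 \subset G by rewrite join_subG cycle_subG groupM //= normal_sub.
have nsB1G : B1 <| G by apply: nclosure_normal.
have nsB2G : B2 <| G by apply: nclosure_normal.
have B1a : a \in B1.
  by rewrite (subsetP (sub_nclosure G A1)) // mem_gen // inE cycle_id.
have B2ab : a * b \in B2.
  by rewrite (subsetP (sub_nclosure G A2)) // mem_gen // inE cycle_id.
have [_ _ _ maxR] := chief_factorP chR.
have sRB2 : R \subset B2 by rewrite -ti2 subsetIr.
have sRB1 : R \subset B1 by rewrite -ti1 subsetIr.
have BBb : b \in B2 <*> B1.
  have -> : b = a^-1 * (a * b) by rewrite mulKg.
  have BBa : a \in B2 <*> B1 by apply: (subsetP (joing_subr _ _)).
  have BBab : a * b \in B2 <*> B1 by apply: (subsetP (joing_subl _ _)).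
  by rewrite groupM ?groupV.
have sDBB : D \subset B2 <*> B1.
  have [||| eqI | eqI] := maxR (D :&: (B2 <*> B1))%G.
  - by rewrite subsetI sRD (subset_trans sRB2) ?joing_subl.
  - exact: subsetIl.
  - by rewrite normsI ?normsY ?normal_norm.
  - by case/negP: Rb; rewrite -eqI inE Db.
  by rewrite -eqI subsetIr.
(* D / R ~ D B1 / B1 = B2 B1 / B1 ~ B2 / K, and the latter is perspective to
   a chief factor above D. *)
have eqDB : (D <*> B1)%G = (B2 <*> B1)%G.
  have sB2 : B2 \subset D <*> B1.
    apply: nclosure_min; last by rewrite normsY ?normal_norm.
    rewrite join_subG cycle_subG (subset_trans sRD) ?joing_subl // andbT.
    apply: groupM; first exact: (subsetP (joing_subr _ _)).
    exact: (subsetP (joing_subl _ _)).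
  apply/group_inj/eqP; rewrite eqEsubset; apply/andP; split.
    by rewrite join_subG sDBB joing_subr.
  by rewrite join_subG sB2 joing_subr.
have eqR : (D :&: B1)%G = R by apply: group_inj.
pose K := (B2 :&: B1)%G; pose L := (K <*> D)%G.
have nsKG : K <| G by apply: normalI.
have nsLG : L <| G by apply: normalY.
have nDK : K \subset 'N(D) by apply: subset_trans (normal_sub nsKG) (normal_norm nsDG).
have eqK : (B2 :&: L)%G = K.
  have eqL : L :=: K * D := norm_joinEl nDK.
  have sKB : K \subset B2 := subsetIl _ _.
  apply/group_inj; transitivity (K * D :&: B2); first by rewrite setIC -eqL.
  by rewrite -group_modl // ti2 mulGSid // subsetI sRB2.
have chK : chief_factor G K B2.
  apply: chief_factor_down => //; rewrite -eqDB.
  by apply: chief_factor_up; rewrite // eqR.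
case: nFR; rewrite -{1}eqR; apply/(F_central_perspective clF nsDG nsB1G).
rewrite eqDB; apply/(F_central_perspective clF nsB2G nsB1G).
rewrite -/K -eqK; apply/(F_central_perspective clF nsB2G nsLG).
apply: chief_central_residual => //; first by apply: chief_factor_up; rewrite // eqK.
by apply/(residual_subP clF formF) => //; apply: joing_subr.
Qed.

End HallProperty.

Lemma residual_Hall : Hall G D.
Proof.
rewrite /Hall sDG; apply: contraT => ncop.
set d := gcdn #|D| #|G : D|; have d_gt1 : 1 < d.
  by rewrite ltn_neqAle eq_sym ncop gcdn_gt0 cardG_gt0.
have p_pr := pdiv_prime d_gt1; have := pdiv_dvd d.
rewrite dvdn_gcd => /andP[pD pGD].
have [R chR sQR] := top_exists (pcore_ntriv p_pr pD).
by have := top_coprime_index chR sQR; rewrite pGD.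
Qed.


Lemma residual_chief_cyclic K H :
  chief_factor G K H -> H \subset D -> cyclic (H / K).
Proof.
move=> chKH sHD; apply: (chief_factor_cyclic chKH) => X _ sXH.
exact: residual_subgroup_norm (subset_trans sXH sHD).
Qed.

End Main.

(** * Power automorphisms and the class of nilpotent groups *)

Lemma power_aut_conj (gT : finGroupType) (X : {group gT}) x :
    (forall Y : {group gT}, Y \subset X -> x \in 'N(Y)) ->
  power_aut X (conj_aut X x).
Proof.
move=> nYx; have nXx := nYx X (subxx X).
split=> [|Y sYX].
  apply: (subsetP (Aut_conj_aut X 'N(X))).
  exact: (mem_morphim (conj_aut_morphism X)).
rewrite -[RHS](normP (nYx Y sYX)); apply: eq_in_imset => y Yy.
by rewrite norm_conj_autE // (subsetP sYX).
Qed.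

Section NilpotentClass.

Lemma nilpotent_is_gclass : is_gclass nilpotent_gclass.
Proof.
split=> [gT rT G H isoGH | gT]; last exact: nilpotent1.
by rewrite /nilpotent_gclass (isog_nil isoGH).
Qed.

(** The term of index [#|G|.+1] of the lower central series of [G] lies in
    every normal subgroup with a nilpotent quotient, hence in the residual. *)
Lemma nilpotent_formation : formation nilpotent_gclass.
Proof.
move=> gT rT G f; apply: morphim_nil; set R := residual _ G.
have [sRG nRG] : R \subset G /\ G \subset 'N(R).
  by apply/andP; apply: (residual_normal nilpotent_is_gclass).
have sLR : 'L_#|G|.+1(G) \subset R.
  apply/bigcapsP=> N /andP[/andP[sNG nNG] /asboolP nilGN].
  rewrite -quotient_sub1; last by apply: subset_trans (lcn_sub _ _) nNG.
  rewrite /quotient morphim_lcn // -/(quotient G N).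
  have /eqP-> // : 'L_#|G|.+1(G / N) == 1.
  apply/eqP/(lcn_nil_classP _ nilGN).
  move: (nilGN); rewrite /nilpotent_gclass nilpotent_class => /ltnW le_nil.
  exact: leq_trans le_nil (leq_quotient _ _).
apply/lcnP; exists #|G|; rewrite /= -morphim_lcn //.
by apply/trivgP; rewrite -/(quotient _ R) quotient_sub1 // (subset_trans (lcn_sub _ _)).
Qed.

Lemma nilpotent_Sylow_normal (gT : finGroupType) (G : {group gT}) :
    (forall P : {group gT}, Sylow G P -> P <| G) -> nilpotent G.
Proof.
move=> nsPG; apply: nilpotentS (Fitting_nil G).
rewrite -{1}(Sylow_gen G) gen_subG; apply/bigcupsP=> P sylP.
apply: Fitting_max; first exact: nsPG.
by have [p _ sylPp] := SylowP _ _ sylP; apply: pgroup_nil (pHall_pgroup sylPp).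
Qed.

(** By the Frattini argument every Sylow subgroup of [G] is normal. *)
Lemma Phi_quotient_nil (gT : finGroupType) (G : {group gT}) :
  nilpotent (G / 'Phi(G)) -> nilpotent G.
Proof.
move=> nilGP; apply: nilpotent_Sylow_normal => P /SylowP[p _ sylP].
have nPhiG := normal_norm (Phi_normal G).
have sPG := pHall_sub sylP; have nPhiP := subset_trans sPG nPhiG.
have nsPPhi : 'Phi(G) <*> P <| G.
  have: P / 'Phi(G) <| G / 'Phi(G).
    rewrite (nilpotent_Hall_pcore nilGP (quotient_pHall nPhiP sylP)).
    exact: pcore_normal.
  rewrite -cosetpre_normal (quotientGK (Phi_normal G)) quotientK //.
  by rewrite norm_joinEr.
have sylPP : p.-Sylow('Phi(G) <*> P) P.
  by apply: pHall_subl sylP; [apply: joing_subr | apply: normal_sub].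
have := Frattini_arg nsPPhi sylPP => defG.
have defN : 'N_G(P) = G.
  rewrite -[LHS]genGid; apply: Phi_nongen; apply/eqP.
  rewrite eqEsubset join_subG Phi_sub subsetIl /= -{1}defG.
  rewrite mul_subG ?joing_subr // join_subG joing_subl /=.
  by apply: subset_trans (joing_subr _ _); rewrite subsetI sPG normG.
by rewrite /normal sPG -defN subsetIr.
Qed.

Lemma nilpotent_saturated : saturated nilpotent_gclass.
Proof.
move=> gT G sRPhi; apply: Phi_quotient_nil.
apply/(residual_subP nilpotent_is_gclass nilpotent_formation) => //.
exact: Phi_normal.
Qed.

Lemma nilpotent_central (gT : finGroupType) (G K H : {group gT}) :
  F_central nilpotent_gclass G K H <-> central_chief G K H.
Proof.
split=> [[ch nilE] | [ch cH]]; have [nsKG nsHG prKH maxK] := chief_factorP ch.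
  have [[nKG nHG] sHG] := (normal_norm nsKG, normal_norm nsHG, normal_sub nsHG).
  have nKH := subset_trans sHG nKG.
  split=> //; pose act := <[chief_acts ch]>%gact.
  pose Z := (H :&: coset K @*^-1 'Z(G / K))%G.
  suffices [h Hh [nKh Zh]] :
      exists2 h, h \in H & h \notin K /\ coset K h \in 'Z(G / K).
    have nZG : G \subset 'N(Z).
      rewrite normsI // -(quotientGK nsKG).
      by apply: normal_norm; rewrite cosetpre_normal center_normal.
    have [||| eqZ | eqZ] := maxK Z => //.
    - by rewrite subsetI proper_sub //= sub_cosetpre.
    - exact: subsetIl.
    - case/negP: nKh; rewrite -eqZ inE Hh /=; apply/morphpreP; split=> //.
      exact: (subsetP nKH).
    by rewrite sub_quotient_pre // -{1}eqZ subsetIr.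
  (* The nontrivial normal subgroup H / K meets the centre of the nilpotent
     semidirect product. *)
  have [nsA1 _ _ _ _] := sdprod_context (sdprod_sdpair act).
  have ntA1 : sdpair1 act @* (H / K) != 1.
    rewrite morphim_injm_eq1 ?injm_sdpair1 // -subG1 quotient_sub1 //.
    exact: proper_subn.
  have /trivgPn[z /setIP[A1z Zz] ntz] := meet_center_nil nilE nsA1 ntA1.
  have [hb _ Hhb def_z] := morphimP A1z.
  have [h Nh Hh def_hb] := morphimP Hhb; exists h => //; split.
    apply: contra ntz => Kh; rewrite def_z def_hb /= coset_id //.
    by rewrite morph1.
  rewrite inE mem_quotient ?(subsetP sHG) //=; apply/centP=> _ /morphimP[g Ng Gg ->].
  apply/commgP/conjg_fixP; rewrite -morphJ //=.
  apply: (injmP (injm_sdpair1 act)); rewrite ?mem_quotient // ?memJ_norm ?(subsetP nHG) //.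
  rewrite -(chief_actE ch) //.
  transitivity (z ^ sdpair2 act (coset (section_cent G K H) g)).
    by rewrite def_z def_hb; apply: (sdpair_act act); apply: mem_quotient.
  transitivity z; last by rewrite def_z def_hb.
  by apply/conjg_fixP/commgP; case/setIP: Zz => _ /centP; apply; rewrite inE.
have [[nKG nHG] sHG] := (normal_norm nsKG, normal_norm nsHG, normal_sub nsHG).
have cHG : H / K \subset 'C(G / K) by apply: subset_trans cH (subsetIr _ _).
have sRK : [~: H, G] \subset K.
  by rewrite -quotient_cents2 // (subset_trans sHG).
apply: central_F_central => //.
  by apply: subset_trans cHG _; apply: centS; apply: quotientS.
apply/subsetP=> x Gx; apply/section_centP => //; split=> // h Hh.
by rewrite (subsetP sRK) ?mem_commg.
Qed.

End NilpotentClass.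

Theorem theorem1p4 (gT : finGroupType) (G : {group gT}) :
  (forall (F : gclass),
     is_gclass F ->
     normally_hereditary F -> saturated F -> formation F ->
     (forall (rT : finGroupType) (H : {group rT}), nilpotent H -> F rT H) ->
     let D := residual F G in
     solvable D ->
     (forall A : {group gT}, L_class G F A <-> L_Delta G (F_central F G) A) ->
     [/\ abelian D, Hall G D & odd #|D|] /\
     (forall x, x \in G ->
        power_aut (D / 'Phi(D))%G
                  (conj_aut (D / 'Phi(D))%G (coset 'Phi(D) x))) /\
     (forall K H : {group gT},
        chief_factor G K H -> H \subset D -> cyclic (H / K)))
  /\
  (solvable G ->
   (forall A : {group gT},
      L_class G nilpotent_gclass A <-> L_Delta G (central_chief G) A) ->
   forall x, x \in G ->
     power_aut (residual nilpotent_gclass G)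
               (conj_aut (residual nilpotent_gclass G) x)).
Proof.
split=> [F clF normF satF formF nilF D solD hL | solG hL x Gx].
  have hL' A : L_class G F A -> L_Delta G (F_central F G) A by move/hL.
  have normD := residual_subgroup_norm clF formF satF nilF solD hL'.
  split; first split.
  - exact: residual_abelian.
  - exact: residual_Hall.
  - exact: residual_odd.
  split; last exact: residual_chief_cyclic.
  move=> x Gx; apply: power_aut_conj => Y sYD.
  have nYG : G \subset 'N(coset 'Phi(D) @*^-1 Y).
    by apply: normD; rewrite sub_cosetpre_quo ?Phi_normal.
  have sGN : G \subset 'N('Phi(D)).
    apply: char_norm_trans (Phi_char D) _.
    exact: normal_norm (residual_normal clF G).
  rewrite -(cosetpreK Y).
  exact: (subsetP (quotient_norms _ nYG)) (mem_quotient _ Gx).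
have clN := nilpotent_is_gclass; have formN := nilpotent_formation.
apply: power_aut_conj => Y sYD; apply: subsetP x Gx.
apply: (residual_subgroup_norm clN formN nilpotent_saturated) sYD => //.
  apply: solvableS solG; exact: normal_sub (residual_normal clN G).
move=> A /hL[sAG [eqA | [prA cA]]]; split=> //; [by left | right].
by split=> // K H ch sK sH; apply/nilpotent_central/cA.
Qed.
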